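(* Let $H$ be an $n$-dimensional generalized Heisenberg Lie algebra of rank $2$ over a field $\mathbb{F}$. (i) If $H$ is non-capable, then $H\otimes H\cong A((n-2)^{2})$ if $Z^{\wedge}(H)=H^{2}$ and $H\otimes H\cong A((n-2)^{2}+2)$ otherwise; and $H\wedge H\cong A\left(\frac12(n-3)(n-2)\right)$ if $Z^{\wedge}(H)=H^{2}$ and $H\wedge H\cong A\left(\frac12(n-1)(n-4)+3\right)$ otherwise. (ii) If $H$ is capable, then $H\otimes H\cong A(14)$ if $H\cong L_{5,8}$; $H\otimes H\cong A(20)$ if $H\cong L_{6,22}(\varepsilon)$ or $H\cong L_{6,7}^{(2)}(\eta)$; $H\otimes H\cong A(26)$ if $H\cong L_{1}$; and $H\wedge H\cong A(8)$ if $H\cong L_{5,8}$; $H\wedge H\cong A(10)$ if $H\cong L_{6,22}(\varepsilon)$ or $H\cong L_{6,7}^{(2)}(\eta)$; $H\wedge H\cong A(11)$ if $H\cong L_{1}$.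
   Context: $\mathbb{F}$ is a fixed field and all Lie algebras are over $\mathbb{F}$. $A(d)$ denotes the abelian Lie algebra of dimension $d$. $L^{2}=[L,L]$ is the derived subalgebra and $Z(L)$ the center. A Lie algebra $H$ is a generalized Heisenberg Lie algebra of rank $r$ if $H^{2}=Z(H)$ and $\dim H^{2}=r$. A Lie algebra $L$ is capable if $L\cong K/Z(K)$ for some Lie algebra $K$. The tensor square $L\otimes L$ is the Lie algebra generated by symbols $a\otimes b$ ($a,b\in L$), bilinear over $\mathbb{F}$ in $a$ and $b$, subject to: $[a,a']\otimes b=a\otimes[a',b]-a'\otimes[a,b]$; $a\otimes[b,b']=[b',a]\otimes b-[b,a]\otimes b'$; $[a\otimes b,\,a'\otimes b']=-[b,a]\otimes[a',b']$. $L\square L$ is the submodule of $L\otimes L$ generated by the elements $l\otimes l$, and the exterior square is $L\wedge L=(L\otimes L)/(L\square L)$, with $l\wedge l'$ the coset of $l\otimes l'$. The exterior center is $Z^{\wedge}(L)=\{l\in L: l\wedge l'=0 \text{ for all } l'\in L\}$. Lie algebras (brackets of basis elements not listed are zero): $L_{5,8}=\langle x_1,\dots,x_5\mid [x_1,x_2]=x_4,\ [x_1,x_3]=x_5\rangle$; $L_{6,22}(\varepsilon)=\langle x_1,\dots,x_6\mid [x_1,x_2]=x_5=[x_3,x_4],\ [x_1,x_3]=x_6,\ [x_2,x_4]=\varepsilon x_6\rangle$, with $\varepsilon\in\mathbb{F}$ (taken up to the equivalence of parameters used in the classification of such algebras up to isomorphism); $L_{6,7}^{(2)}(\eta)=\langle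 x_1,\dots,x_6\mid [x_1,x_2]=x_5,\ [x_1,x_3]=x_6,\ [x_2,x_4]=\eta x_6,\ [x_3,x_4]=x_5+x_6\rangle$, with $\eta\in\{0,\omega\}$, where (this algebra occurring for fields of characteristic $2$) $\omega$ is a fixed element of $\mathbb{F}$ not of the form $\gamma^2+\gamma$ with $\gamma\in\mathbb{F}$; $L_{1}=\langle x_1,\dots,x_7\mid [x_1,x_2]=x_6=[x_3,x_4],\ [x_1,x_5]=x_7=[x_2,x_3]\rangle$. *)

(* Defs.v *)
From HB Require Import structures.
From mathcomp Require Import all_boot all_order all_algebra.
From mathcomp Require Import generic_quotient boolp classical_sets.

Set Implicit Arguments.
Unset Strict Implicit.
Unset Printing Implicit Defensive.

Import GRing.Theory.
Local Open Scope ring_scope.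
Local Open Scope classical_set_scope.
Local Open Scope quotient_scope.

HB.mixin Record isLieAlgebra (F : fieldType) L of GRing.Lmodule F L := {
  lie : L -> L -> L;
  lieDl : forall x y z, lie (x + y) z = lie x z + lie y z;
  lieZl : forall a x y, lie (a *: x) y = a *: lie x y;
  lieDr : forall x y z, lie x (y + z) = lie x y + lie x z;
  lieZr : forall a x y, lie x (a *: y) = a *: lie x y;
  liexx : forall x, lie x x = 0;
  lie_jacobi : forall x y z,
    lie x (lie y z) + lie y (lie z x) + lie z (lie x y) = 0
}.

#[short(type="lieAlgType")]
HB.structure Definition LieAlgebra (F : fieldType) :=
  {L of GRing.Lmodule F L & isLieAlgebra F L}.

#[short(type="vectLieType")]
HB.structure Definition VectLie (F : fieldType) :=
  {L of LieAlgebra F L & Vector F L}.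

Section LieTheory.
Variables (F : fieldType) (L : lieAlgType F).
Implicit Types x y z : L.

Lemma lie0l x : lie 0 x = 0.
Proof. by have := lieZl 0 0 x; rewrite !scale0r. Qed.

Lemma lie0r x : lie x 0 = 0.
Proof. by have := lieZr 0 x 0; rewrite !scale0r. Qed.

Lemma lieNl x y : lie (- x) y = - lie x y.
Proof. by rewrite -scaleN1r lieZl scaleN1r. Qed.

Lemma lieNr x y : lie x (- y) = - lie x y.
Proof. by rewrite -scaleN1r lieZr scaleN1r. Qed.

Lemma lieBr x y z : lie x (y - z) = lie x y - lie x z.
Proof. by rewrite lieDr lieNr. Qed.

Lemma lieBl x y z : lie (x - y) z = lie x z - lie y z.
Proof. by rewrite lieDl lieNl. Qed.

Lemma lieC x y : lie x y = - lie y x.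
Proof.
have := liexx (x + y); rewrite lieDl !lieDr !liexx add0r addr0.
by move/eqP; rewrite addr_eq0 => /eqP.
Qed.

End LieTheory.

Definition lie_isomorphic (F : fieldType) (L M : lieAlgType F) : Prop :=
  exists f : {linear L -> M},
    bijective f /\ (forall x y, f (lie x y) = lie (f x) (f y)).

Definition lin_span (F : fieldType) (V : lmodType F) (A : set V) : set V :=
  [set v | exists s : seq (F * V),
     (forall p, p \in s -> A p.2) /\ v = \sum_(p <- s) p.1 *: p.2].

Definition derived (F : fieldType) (L : lieAlgType F) : set L :=
  lin_span [set z | exists x y : L, z = lie x y].

Definition center (F : fieldType) (L : lieAlgType F) : set L :=
  [set z | forall x : L, lie z x = 0].

Arguments derived {F} L _.
Arguments center {F} L _.

Definition generalized_heisenberg (F : fieldType) (r : nat)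
    (H : vectLieType F) : Prop :=
  derived H = center H /\
  exists2 U : {vspace H}, [set x | x \in U] = derived H & \dim U = r.

(* Quotients.  A [lie_setoid] is a set with operations that satisfy the Lie
   algebra axioms modulo a congruence [ls_eq]; its quotient is a Lie algebra.
   Quotients by ideals and algebras given by generators and relations are both
   instances. *)

Record lie_setoid (F : fieldType) := LieSetoid {
  ls_sort : Type;
  ls_zero : ls_sort;
  ls_opp : ls_sort -> ls_sort;
  ls_add : ls_sort -> ls_sort -> ls_sort;
  ls_scale : F -> ls_sort -> ls_sort;
  ls_lie : ls_sort -> ls_sort -> ls_sort;
  ls_eq : ls_sort -> ls_sort -> Prop;
  ls_refl : forall x, ls_eq x x;
  ls_sym : forall x y, ls_eq x y -> ls_eq y x;
  ls_trans : forall x y z, ls_eq x y -> ls_eq y z -> ls_eq x z;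
  ls_opp_eq : forall x x', ls_eq x x' -> ls_eq (ls_opp x) (ls_opp x');
  ls_add_eq : forall x x' y y', ls_eq x x' -> ls_eq y y' ->
    ls_eq (ls_add x y) (ls_add x' y');
  ls_scale_eq : forall a x x', ls_eq x x' -> ls_eq (ls_scale a x) (ls_scale a x');
  ls_lie_eq : forall x x' y y', ls_eq x x' -> ls_eq y y' ->
    ls_eq (ls_lie x y) (ls_lie x' y');
  ls_addA : forall x y z,
    ls_eq (ls_add x (ls_add y z)) (ls_add (ls_add x y) z);
  ls_addC : forall x y, ls_eq (ls_add x y) (ls_add y x);
  ls_add0 : forall x, ls_eq (ls_add ls_zero x) x;
  ls_addN : forall x, ls_eq (ls_add (ls_opp x) x) ls_zero;
  ls_scaleA : forall a b x,
    ls_eq (ls_scale a (ls_scale b x)) (ls_scale (a * b) x);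
  ls_scale1 : forall x, ls_eq (ls_scale 1 x) x;
  ls_scaleDr : forall a x y,
    ls_eq (ls_scale a (ls_add x y)) (ls_add (ls_scale a x) (ls_scale a y));
  ls_scaleDl : forall x a b,
    ls_eq (ls_scale (a + b) x) (ls_add (ls_scale a x) (ls_scale b x));
  ls_lieDl : forall x y z,
    ls_eq (ls_lie (ls_add x y) z) (ls_add (ls_lie x z) (ls_lie y z));
  ls_lieZl : forall a x y,
    ls_eq (ls_lie (ls_scale a x) y) (ls_scale a (ls_lie x y));
  ls_lieDr : forall x y z,
    ls_eq (ls_lie x (ls_add y z)) (ls_add (ls_lie x y) (ls_lie x z));
  ls_lieZr : forall a x y,
    ls_eq (ls_lie x (ls_scale a y)) (ls_scale a (ls_lie x y));
  ls_liexx : forall x, ls_eq (ls_lie x x) ls_zero;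
  ls_jacobi : forall x y z,
    ls_eq (ls_add (ls_add (ls_lie x (ls_lie y z)) (ls_lie y (ls_lie z x)))
                  (ls_lie z (ls_lie x y))) ls_zero
}.

Section LieQuotient.
Variables (F : fieldType) (S : lie_setoid F).
Local Notation T := {classic (ls_sort S)}.
Implicit Types x y z : T.

Definition ls_rel : rel T := fun x y => `[< ls_eq x y >].

Fact ls_rel_refl : reflexive ls_rel.
Proof. by move=> x; apply/asboolP/ls_refl. Qed.

Fact ls_rel_sym : symmetric ls_rel.
Proof. by move=> x y; apply/asboolP/asboolP; apply: ls_sym. Qed.

Fact ls_rel_trans : transitive ls_rel.
Proof. by move=> y x z /asboolP xy /asboolP yz; apply/asboolP/(ls_trans xy). Qed.

Canonical ls_equiv := EquivRel ls_rel ls_rel_refl ls_rel_sym ls_rel_trans.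

Definition lie_quotient : Type := {eq_quot ls_equiv}.
HB.instance Definition _ := Choice.on lie_quotient.

Definition lie_class (x : ls_sort S) : lie_quotient := \pi_{eq_quot ls_equiv} (x : T).
Definition lie_repr (u : lie_quotient) : ls_sort S :=
  repr (u : {eq_quot ls_equiv}).

Lemma lie_reprK u : lie_class (lie_repr u) = u.
Proof. exact: (@reprK _ {eq_quot ls_equiv}). Qed.

Lemma lie_classP (x y : ls_sort S) : lie_class x = lie_class y <-> ls_eq x y.
Proof.
split=> [/(@eqmodP T ls_equiv x y)/asboolP //|xy].
exact/(@eqmodP T ls_equiv x y)/asboolP.
Qed.

Lemma lie_repr_class x : ls_eq (lie_repr (lie_class x)) x.
Proof. by apply/lie_classP; rewrite lie_reprK. Qed.

Lemma lie_quotientP (P : lie_quotient -> Prop) :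
  (forall x, P (lie_class x)) -> forall u, P u.
Proof. by move=> Px u; rewrite -(lie_reprK u). Qed.

Definition lq_opp u := lie_class (ls_opp (lie_repr u)).
Definition lq_add u v := lie_class (ls_add (lie_repr u) (lie_repr v)).
Definition lq_scale a u := lie_class (ls_scale a (lie_repr u)).
Definition lq_lie u v := lie_class (ls_lie (lie_repr u) (lie_repr v)).

Lemma lq_oppE x : lq_opp (lie_class x) = lie_class (ls_opp x).
Proof. by apply/lie_classP/ls_opp_eq/lie_repr_class. Qed.

Lemma lq_addE x y : lq_add (lie_class x) (lie_class y) = lie_class (ls_add x y).
Proof. by apply/lie_classP/ls_add_eq; apply: lie_repr_class. Qed.

Lemma lq_scaleE a x : lq_scale a (lie_class x) = lie_class (ls_scale a x).
Proof. by apply/lie_classP/ls_scale_eq/lie_repr_class. Qed.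

Lemma lq_lieE x y : lq_lie (lie_class x) (lie_class y) = lie_class (ls_lie x y).
Proof. by apply/lie_classP/ls_lie_eq; apply: lie_repr_class. Qed.

Fact lq_addA : associative lq_add.
Proof.
elim/lie_quotientP=> x; elim/lie_quotientP=> y; elim/lie_quotientP=> z.
by rewrite !lq_addE; apply/lie_classP/ls_addA.
Qed.

Fact lq_addC : commutative lq_add.
Proof.
elim/lie_quotientP=> x; elim/lie_quotientP=> y.
by rewrite !lq_addE; apply/lie_classP/ls_addC.
Qed.

Fact lq_add0 : left_id (lie_class (ls_zero S)) lq_add.
Proof.
by elim/lie_quotientP=> x; rewrite !lq_addE; apply/lie_classP/ls_add0.
Qed.

Fact lq_addN : left_inverse (lie_class (ls_zero S)) lq_opp lq_add.
Proof.
by elim/lie_quotientP=> x; rewrite lq_oppE lq_addE; apply/lie_classP/ls_addN.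
Qed.

HB.instance Definition _ :=
  GRing.isZmodule.Build lie_quotient lq_addA lq_addC lq_add0 lq_addN.

Lemma lie_class0 : lie_class (ls_zero S) = 0.
Proof. by []. Qed.

Lemma lie_classN x : lie_class (ls_opp x) = - lie_class x.
Proof. by rewrite -lq_oppE. Qed.

Lemma lie_classD x y : lie_class (ls_add x y) = lie_class x + lie_class y.
Proof. by rewrite -lq_addE. Qed.

Fact lq_scaleA a b u : lq_scale a (lq_scale b u) = lq_scale (a * b) u.
Proof.
elim/lie_quotientP: u => x.
by rewrite !lq_scaleE; apply/lie_classP/ls_scaleA.
Qed.

Fact lq_scale1 : left_id 1 lq_scale.
Proof.
by elim/lie_quotientP=> x; rewrite lq_scaleE; apply/lie_classP/ls_scale1.
Qed.

Fact lq_scaleDr : right_distributive lq_scale +%R.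
Proof.
move=> a; elim/lie_quotientP=> x; elim/lie_quotientP=> y.
rewrite -lie_classD !lq_scaleE -lie_classD.
exact/lie_classP/ls_scaleDr.
Qed.

Fact lq_scaleDl u : {morph lq_scale^~ u : a b / a + b}.
Proof.
elim/lie_quotientP: u => x a b /=.
rewrite !lq_scaleE -lie_classD.
exact/lie_classP/ls_scaleDl.
Qed.

HB.instance Definition _ := GRing.Zmodule_isLmodule.Build F lie_quotient
  lq_scaleA lq_scale1 lq_scaleDr lq_scaleDl.

Lemma lie_classZ a x : lie_class (ls_scale a x) = a *: lie_class x.
Proof. by rewrite -lq_scaleE. Qed.

Fact lq_lieDl u v w : lq_lie (u + v) w = lq_lie u w + lq_lie v w.
Proof.
elim/lie_quotientP: u => x; elim/lie_quotientP: v => y.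
elim/lie_quotientP: w => z; rewrite -lie_classD !lq_lieE -lie_classD.
exact/lie_classP/ls_lieDl.
Qed.

Fact lq_lieZl a u v : lq_lie (a *: u) v = a *: lq_lie u v.
Proof.
elim/lie_quotientP: u => x; elim/lie_quotientP: v => y.
rewrite -lie_classZ !lq_lieE -lie_classZ; exact/lie_classP/ls_lieZl.
Qed.

Fact lq_lieDr u v w : lq_lie u (v + w) = lq_lie u v + lq_lie u w.
Proof.
elim/lie_quotientP: u => x; elim/lie_quotientP: v => y.
elim/lie_quotientP: w => z; rewrite -lie_classD !lq_lieE -lie_classD.
exact/lie_classP/ls_lieDr.
Qed.

Fact lq_lieZr a u v : lq_lie u (a *: v) = a *: lq_lie u v.
Proof.
elim/lie_quotientP: u => x; elim/lie_quotientP: v => y.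
rewrite -lie_classZ !lq_lieE -lie_classZ; exact/lie_classP/ls_lieZr.
Qed.

Fact lq_liexx u : lq_lie u u = 0.
Proof.
elim/lie_quotientP: u => x; rewrite lq_lieE -lie_class0.
exact/lie_classP/ls_liexx.
Qed.

Fact lq_jacobi u v w :
  lq_lie u (lq_lie v w) + lq_lie v (lq_lie w u) + lq_lie w (lq_lie u v) = 0.
Proof.
elim/lie_quotientP: u => x; elim/lie_quotientP: v => y.
elim/lie_quotientP: w => z; rewrite !lq_lieE -!lie_classD -lie_class0.
exact/lie_classP/ls_jacobi.
Qed.

HB.instance Definition _ := isLieAlgebra.Build F lie_quotient
  lq_lieDl lq_lieZl lq_lieDr lq_lieZr lq_liexx lq_jacobi.

Lemma lie_class_lie x y : lie_class (ls_lie x y) = lie (lie_class x) (lie_class y).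
Proof. by rewrite -lq_lieE. Qed.

End LieQuotient.

Record lie_ideal (F : fieldType) (L : lieAlgType F) := LieIdeal {
  ideal_set : set L;
  ideal0 : ideal_set 0;
  idealD : forall x y, ideal_set x -> ideal_set y -> ideal_set (x + y);
  idealZ : forall a x, ideal_set x -> ideal_set (a *: x);
  ideal_lie : forall x y, ideal_set y -> ideal_set (lie x y)
}.

Section IdealQuotient.
Variables (F : fieldType) (L : lieAlgType F) (I : lie_ideal L).
Implicit Types x y z : L.

Definition ideal_eq x y : Prop := ideal_set I (x - y).

Lemma idealN x : ideal_set I x -> ideal_set I (- x).
Proof. by move=> Ix; rewrite -scaleN1r; apply: idealZ. Qed.

Lemma ideal_lie_r x y : ideal_set I x -> ideal_set I (lie x y).
Proof. by move=> Ix; rewrite lieC; apply/idealN/ideal_lie. Qed.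

Lemma ideal_eq_of x y : x = y -> ideal_eq x y.
Proof. by move->; rewrite /ideal_eq subrr; apply: ideal0. Qed.

Lemma ideal_eq_sym x y : ideal_eq x y -> ideal_eq y x.
Proof. by rewrite /ideal_eq => /idealN; rewrite opprB. Qed.

Lemma ideal_eq_trans x y z : ideal_eq x y -> ideal_eq y z -> ideal_eq x z.
Proof. by move=> xy /(idealD xy); rewrite /ideal_eq addrA subrK. Qed.

Lemma ideal_eq_opp x x' : ideal_eq x x' -> ideal_eq (- x) (- x').
Proof. by rewrite /ideal_eq => /idealN; rewrite opprD. Qed.

Lemma ideal_eq_add x x' y y' :
  ideal_eq x x' -> ideal_eq y y' -> ideal_eq (x + y) (x' + y').
Proof. by move=> xx' /(idealD xx'); rewrite /ideal_eq addrACA opprD. Qed.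

Lemma ideal_eq_scale (a : F) x x' : ideal_eq x x' -> ideal_eq (a *: x) (a *: x').
Proof. by rewrite /ideal_eq => /(idealZ a); rewrite scalerBr. Qed.

Lemma ideal_eq_lie x x' y y' :
  ideal_eq x x' -> ideal_eq y y' -> ideal_eq (lie x y) (lie x' y').
Proof.
move=> xx' yy'; apply: (@ideal_eq_trans _ (lie x' y)); rewrite /ideal_eq.
  by rewrite -lieBl; apply: ideal_lie_r.
by rewrite -lieBr; apply: ideal_lie.
Qed.

Definition ideal_setoid : lie_setoid F.
Proof.
apply: (@LieSetoid F L 0 -%R +%R *:%R lie ideal_eq).
- by move=> x; apply: ideal_eq_of.
- exact: ideal_eq_sym.
- exact: ideal_eq_trans.
- exact: ideal_eq_opp.
- exact: ideal_eq_add.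
- exact: ideal_eq_scale.
- exact: ideal_eq_lie.
- by move=> *; apply/ideal_eq_of/addrA.
- by move=> *; apply/ideal_eq_of/addrC.
- by move=> *; apply/ideal_eq_of/add0r.
- by move=> *; apply/ideal_eq_of/addNr.
- by move=> *; apply/ideal_eq_of/scalerA.
- by move=> *; apply/ideal_eq_of/scale1r.
- by move=> *; apply/ideal_eq_of/scalerDr.
- by move=> *; apply/ideal_eq_of/scalerDl.
- by move=> *; apply/ideal_eq_of/lieDl.
- by move=> *; apply/ideal_eq_of/lieZl.
- by move=> *; apply/ideal_eq_of/lieDr.
- by move=> *; apply/ideal_eq_of/lieZr.
- by move=> *; apply/ideal_eq_of/liexx.
- by move=> *; apply/ideal_eq_of/lie_jacobi.
Defined.

Definition quotient_by : lieAlgType F := lie_quotient ideal_setoid.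
Definition coset_by (x : L) : quotient_by := @lie_class F ideal_setoid x.

End IdealQuotient.

Section Center.
Variables (F : fieldType) (L : lieAlgType F).

Fact center0 : center L 0.
Proof. by move=> x; rewrite lie0l. Qed.

Fact centerD x y : center L x -> center L y -> center L (x + y).
Proof. by move=> Zx Zy z; rewrite lieDl Zx Zy addr0. Qed.

Fact centerZ (a : F) x : center L x -> center L (a *: x).
Proof. by move=> Zx z; rewrite lieZl Zx scaler0. Qed.

Fact center_lie x y : center L y -> center L (lie x y).
Proof. by move=> Zy; rewrite lieC Zy oppr0; apply: center0. Qed.

Definition center_ideal : lie_ideal L :=
  LieIdeal center0 centerD centerZ center_lie.

End Center.

Definition capable (F : fieldType) (L : lieAlgType F) : Prop :=
  exists K : lieAlgType F, lie_isomorphic L (quotient_by (center_ideal K)).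

Section TensorSquare.
Variables (F : fieldType) (L : lieAlgType F).

Inductive tensor_word : Type :=
| TGen (a b : L)
| TZero
| TOpp (u : tensor_word)
| TAdd (u v : tensor_word)
| TScale (c : F) (u : tensor_word)
| TLie (u v : tensor_word).

Local Notation "u ~~> v" := (TAdd u (TOpp v)) (at level 50, only parsing).

(* The smallest Lie algebra congruence that contains the defining relations
   (the constructors [teq_gen...]). *)
Inductive tensor_eq : tensor_word -> tensor_word -> Prop :=
| teq_refl u : tensor_eq u u
| teq_sym u v : tensor_eq u v -> tensor_eq v u
| teq_trans u v w : tensor_eq u v -> tensor_eq v w -> tensor_eq u w
| teq_opp_eq u u' : tensor_eq u u' -> tensor_eq (TOpp u) (TOpp u')
| teq_add_eq u u' v v' : tensor_eq u u' -> tensor_eq v v' ->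
    tensor_eq (TAdd u v) (TAdd u' v')
| teq_scale_eq c u u' : tensor_eq u u' -> tensor_eq (TScale c u) (TScale c u')
| teq_lie_eq u u' v v' : tensor_eq u u' -> tensor_eq v v' ->
    tensor_eq (TLie u v) (TLie u' v')
| teq_addA u v w : tensor_eq (TAdd u (TAdd v w)) (TAdd (TAdd u v) w)
| teq_addC u v : tensor_eq (TAdd u v) (TAdd v u)
| teq_add0 u : tensor_eq (TAdd TZero u) u
| teq_addN u : tensor_eq (TAdd (TOpp u) u) TZero
| teq_scaleA c d u : tensor_eq (TScale c (TScale d u)) (TScale (c * d) u)
| teq_scale1 u : tensor_eq (TScale 1 u) u
| teq_scaleDr c u v :
    tensor_eq (TScale c (TAdd u v)) (TAdd (TScale c u) (TScale c v))
| teq_scaleDl u c d :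
    tensor_eq (TScale (c + d) u) (TAdd (TScale c u) (TScale d u))
| teq_lieDl u v w :
    tensor_eq (TLie (TAdd u v) w) (TAdd (TLie u w) (TLie v w))
| teq_lieZl c u v : tensor_eq (TLie (TScale c u) v) (TScale c (TLie u v))
| teq_lieDr u v w :
    tensor_eq (TLie u (TAdd v w)) (TAdd (TLie u v) (TLie u w))
| teq_lieZr c u v : tensor_eq (TLie u (TScale c v)) (TScale c (TLie u v))
| teq_liexx u : tensor_eq (TLie u u) TZero
| teq_jacobi u v w :
    tensor_eq (TAdd (TAdd (TLie u (TLie v w)) (TLie v (TLie w u)))
                    (TLie w (TLie u v))) TZero
| teq_genDl a a' b :
    tensor_eq (TGen (a + a') b) (TAdd (TGen a b) (TGen a' b))
| teq_genZl c a b : tensor_eq (TGen (c *: a) b) (TScale c (TGen a b))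
| teq_genDr a b b' :
    tensor_eq (TGen a (b + b')) (TAdd (TGen a b) (TGen a b'))
| teq_genZr c a b : tensor_eq (TGen a (c *: b)) (TScale c (TGen a b))
| teq_gen_liel a a' b :
    tensor_eq (TGen (lie a a') b)
              (TAdd (TGen a (lie a' b)) (TOpp (TGen a' (lie a b))))
| teq_gen_lier a b b' :
    tensor_eq (TGen a (lie b b'))
              (TAdd (TGen (lie b' a) b) (TOpp (TGen (lie b a) b')))
| teq_gen_lie a b a' b' :
    tensor_eq (TLie (TGen a b) (TGen a' b'))
              (TOpp (TGen (lie b a) (lie a' b'))).

Definition tensor_setoid : lie_setoid F := LieSetoid
  teq_refl teq_sym teq_trans teq_opp_eq teq_add_eq teq_scale_eq teq_lie_eq
  teq_addA teq_addC teq_add0 teq_addN teq_scaleA teq_scale1 teq_scaleDr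
  teq_scaleDl teq_lieDl teq_lieZl teq_lieDr teq_lieZr teq_liexx teq_jacobi.

Definition tensor_square : lieAlgType F := lie_quotient tensor_setoid.
Definition tens (a b : L) : tensor_square := @lie_class F tensor_setoid (TGen a b).

Lemma tens_lie a b a' b' :
  lie (tens a b) (tens a' b') = - tens (lie b a) (lie a' b').
Proof.
rewrite /tens -lie_class_lie -lie_classN.
exact/(@lie_classP F tensor_setoid)/teq_gen_lie.
Qed.

Lemma tens0l b : tens 0 b = 0.
Proof.
rewrite -(scale0r (0 : L)) -[RHS](scale0r (tens 0 b)) /tens -lie_classZ.
exact/(@lie_classP F tensor_setoid)/teq_genZl.
Qed.

Lemma tens0r a : tens a 0 = 0.
Proof.
rewrite -(scale0r (0 : L)) -[RHS](scale0r (tens a 0)) /tens -lie_classZ.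
exact/(@lie_classP F tensor_setoid)/teq_genZr.
Qed.

Lemma lie_tens_diag (u : tensor_square) l : lie u (tens l l) = 0.
Proof.
elim/(@lie_quotientP F tensor_setoid): u; elim=> [a b||u IHu|u IHu v IHv|c u IHu|u IHu v IHv].
- by rewrite -/(tens a b) tens_lie liexx tens0r oppr0.
- by rewrite (lie_class0 tensor_setoid) lie0l.
- by rewrite (@lie_classN F tensor_setoid u) lieNl IHu oppr0.
- by rewrite (@lie_classD F tensor_setoid u v) lieDl IHu IHv addr0.
- by rewrite (@lie_classZ F tensor_setoid c u) lieZl IHu scaler0.
rewrite (@lie_class_lie F tensor_setoid u v) lieC.
set U := @lie_class F tensor_setoid u in IHu *.
set V := @lie_class F tensor_setoid v in IHv *.
have := lie_jacobi (tens l l) U V.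
by rewrite IHv lie0r (lieC _ U) IHu oppr0 lie0r !addr0 => ->; rewrite oppr0.
Qed.

Definition box_square : set tensor_square :=
  lin_span [set t | exists l : L, t = tens l l].

Fact box_square0 : box_square 0.
Proof. by exists [::]; split=> //; rewrite big_nil. Qed.

Fact box_squareD x y : box_square x -> box_square y -> box_square (x + y).
Proof.
move=> [s [sA ->]] [t [tA ->]]; exists (s ++ t); split; last by rewrite big_cat.
by move=> p; rewrite mem_cat => /orP[/sA|/tA].
Qed.

Fact box_squareZ (c : F) x : box_square x -> box_square (c *: x).
Proof.
move=> [s [sA ->]]; exists [seq (c * p.1, p.2) | p <- s]; split.
  by move=> _ /mapP[p /sA Ap ->].
by rewrite big_map scaler_sumr; apply: eq_bigr => p _ /=; rewrite scalerA.
Qed.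

Fact box_square_lie x y : box_square y -> box_square (lie x y).
Proof.
move=> [s [sA ->]]; suff -> : lie x (\sum_(p <- s) p.1 *: p.2) = 0.
  exact: box_square0.
elim: s sA => [|p s IHs] sA; first by rewrite big_nil lie0r.
have [l pl] := sA p (mem_head _ _).
rewrite big_cons lieDr lieZr pl lie_tens_diag scaler0 add0r IHs //.
by move=> q qs; apply: sA; rewrite inE qs orbT.
Qed.

Definition box_ideal : lie_ideal tensor_square :=
  LieIdeal box_square0 box_squareD box_squareZ box_square_lie.

Definition exterior_square : lieAlgType F := quotient_by box_ideal.
Definition wedge (a b : L) : exterior_square := coset_by box_ideal (tens a b).

Definition exterior_center : set L := [set l | forall l', wedge l l' = 0].

End TensorSquare.

Arguments exterior_center {F} L _.
Arguments box_square {F} L _.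

Section AbelianLie.
Variables (F : fieldType) (d : nat).

Definition abelian_rV : Type := 'rV[F]_d.
HB.instance Definition _ := GRing.Lmodule.on abelian_rV.

Let zero_lie (_ _ : abelian_rV) : abelian_rV := 0.

Fact zero_lieDl x y z : zero_lie (x + y) z = zero_lie x z + zero_lie y z.
Proof. by rewrite addr0. Qed.
Fact zero_lieZl (a : F) x y : zero_lie (a *: x) y = a *: zero_lie x y.
Proof. by rewrite scaler0. Qed.
Fact zero_lieDr x y z : zero_lie x (y + z) = zero_lie x y + zero_lie x z.
Proof. by rewrite addr0. Qed.
Fact zero_lieZr (a : F) x y : zero_lie x (a *: y) = a *: zero_lie x y.
Proof. by rewrite scaler0. Qed.
Fact zero_liexx x : zero_lie x x = 0.
Proof. by []. Qed.
Fact zero_jacobi x y z : zero_lie x (zero_lie y z) + zero_lie y (zero_lie z x)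
  + zero_lie z (zero_lie x y) = 0.
Proof. by rewrite !addr0. Qed.

HB.instance Definition _ := isLieAlgebra.Build F abelian_rV
  zero_lieDl zero_lieZl zero_lieDr zero_lieZr zero_liexx zero_jacobi.

Definition abelian_lie : lieAlgType F := abelian_rV.

End AbelianLie.

(* Lie algebras of dimension n.+1 with basis x_1, ..., x_(n.+1) (so [xvec k]
   is only meant for 1 <= k <= n.+1), given by a multiplication table.  An entry
   (i, j, v) stands for [x_i, x_j] = v = - [x_j, x_i]; brackets that are not
   listed vanish.  The condition [table_nil2] says that the x_i and x_j of the
   entries have coordinate 0 in all the values v, so that every double bracket
   vanishes and the Jacobi identity holds. *)

Section Tables.
Variables (F : fieldType) (n : nat).

Definition xvec (k : nat) : 'rV[F]_n.+1 := delta_mx 0 (inord k.-1).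
Definition xcoord (v : 'rV[F]_n.+1) (k : nat) : F := v 0 (inord k.-1).

Record lie_table := LieTable {
  table_entries : seq (nat * nat * 'rV[F]_n.+1);
  table_nil2 : forall e e', e \in table_entries -> e' \in table_entries ->
    xcoord e'.2 e.1.1 = 0 /\ xcoord e'.2 e.1.2 = 0
}.

Variable t : lie_table.

Definition table_rV : Type := let _ := t in 'rV[F]_n.+1.
HB.instance Definition _ := Vector.on table_rV.

Definition table_lie (x y : table_rV) : table_rV :=
  \sum_(e <- table_entries t)
    (xcoord x e.1.1 * xcoord y e.1.2 - xcoord x e.1.2 * xcoord y e.1.1) *: e.2.

Lemma xcoordD (x y : 'rV[F]_n.+1) k : xcoord (x + y) k = xcoord x k + xcoord y k.
Proof. by rewrite /xcoord mxE. Qed.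

Lemma xcoordZ a (x : 'rV[F]_n.+1) k : xcoord (a *: x) k = a * xcoord x k.
Proof. by rewrite /xcoord mxE. Qed.

Fact table_lieC (x y : table_rV) : table_lie x y = - table_lie y x.
Proof.
rewrite /table_lie -sumrN; apply: eq_bigr => e _.
by rewrite -scaleNr opprB [xcoord x _ * _]mulrC [xcoord x _ * _]mulrC.
Qed.

Fact table_lieDl (x y z : table_rV) :
  table_lie (x + y) z = table_lie x z + table_lie y z.
Proof.
rewrite /table_lie -big_split; apply: eq_bigr => e _ /=.
by rewrite -scalerDl !xcoordD !mulrDl opprD addrACA.
Qed.

Fact table_lieZl (a : F) (x y : table_rV) :
  table_lie (a *: x) y = a *: table_lie x y.
Proof.
rewrite /table_lie scaler_sumr; apply: eq_bigr => e _ /=.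
by rewrite scalerA !xcoordZ mulrBr !mulrA.
Qed.

Fact table_lieDr (x y z : table_rV) :
  table_lie x (y + z) = table_lie x y + table_lie x z.
Proof. by rewrite table_lieC table_lieDl opprD -!table_lieC. Qed.

Fact table_lieZr (a : F) (x y : table_rV) :
  table_lie x (a *: y) = a *: table_lie x y.
Proof. by rewrite table_lieC table_lieZl -scalerN -table_lieC. Qed.

Fact table_liexx (x : table_rV) : table_lie x x = 0.
Proof.
by rewrite /table_lie big1 // => e _; rewrite [X in _ - X]mulrC subrr scale0r.
Qed.

Lemma table_lie2 (x y z : table_rV) : table_lie x (table_lie y z) = 0.
Proof.
suff c0 e : e \in table_entries t ->
    xcoord (table_lie y z) e.1.1 = 0 /\ xcoord (table_lie y z) e.1.2 = 0.
  rewrite /table_lie big_seq big1 // => e /c0[-> ->].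
  by rewrite !mulr0 subrr scale0r.
move=> et; rewrite /xcoord /table_lie !summxE.
split; rewrite big_seq big1 // => e' e't; have [c1 c2] := table_nil2 et e't.
  by rewrite mxE [X in _ * X]c1 mulr0.
by rewrite mxE [X in _ * X]c2 mulr0.
Qed.

Fact table_jacobi (x y z : table_rV) : table_lie x (table_lie y z)
  + table_lie y (table_lie z x) + table_lie z (table_lie x y) = 0.
Proof. by rewrite !table_lie2 !addr0. Qed.

HB.instance Definition _ := isLieAlgebra.Build F table_rV
  table_lieDl table_lieZl table_lieDr table_lieZr table_liexx table_jacobi.

Definition table_algebra : vectLieType F := table_rV.

End Tables.

Section NamedAlgebras.
Variable F : fieldType.

Local Notation x k := (xvec F _ k).

Let xcoordE n k i : (0 < k <= n.+1)%N -> (0 < i <= n.+1)%N ->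
  xcoord (xvec F n k) i = (i == k)%:R.
Proof.
case: k i => [|k] [|i] //= kn i_n.
by rewrite /xcoord mxE eqxx -val_eqE /= !inordK // eqSS.
Qed.

Definition entries_5_8 : seq (nat * nat * 'rV[F]_5) :=
  [:: (1, 2, x 4); (1, 3, x 5)]%N.

Definition entries_6_22 (eps : F) : seq (nat * nat * 'rV[F]_6) :=
  [:: (1, 2, x 5); (3, 4, x 5); (1, 3, x 6); (2, 4, eps *: x 6)]%N.

Definition entries_6_7_2 (eta : F) : seq (nat * nat * 'rV[F]_6) :=
  [:: (1, 2, x 5); (1, 3, x 6); (2, 4, eta *: x 6); (3, 4, (x 5 + x 6)%R)]%N.

Definition entries_1 : seq (nat * nat * 'rV[F]_7) :=
  [:: (1, 2, x 6); (3, 4, x 6); (1, 5, x 7); (2, 3, x 7)]%N.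

Fact nil2_5_8 e e' : e \in entries_5_8 -> e' \in entries_5_8 ->
  xcoord e'.2 e.1.1 = 0 /\ xcoord e'.2 e.1.2 = 0.
Proof.
by rewrite !inE => /orP[]/eqP-> /orP[]/eqP->; rewrite /= !xcoordE.
Qed.

Fact nil2_6_22 eps e e' : e \in entries_6_22 eps -> e' \in entries_6_22 eps ->
  xcoord e'.2 e.1.1 = 0 /\ xcoord e'.2 e.1.2 = 0.
Proof.
by rewrite !inE => /or4P[]/eqP-> /or4P[]/eqP->;
  rewrite /= ?xcoordD ?xcoordZ !xcoordE //= ?addr0 ?mulr0.
Qed.

Fact nil2_6_7_2 eta e e' : e \in entries_6_7_2 eta ->
  e' \in entries_6_7_2 eta -> xcoord e'.2 e.1.1 = 0 /\ xcoord e'.2 e.1.2 = 0.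
Proof.
by rewrite !inE => /or4P[]/eqP-> /or4P[]/eqP->;
  rewrite /= ?xcoordD ?xcoordZ !xcoordE //= ?addr0 ?mulr0.
Qed.

Fact nil2_1 e e' : e \in entries_1 -> e' \in entries_1 ->
  xcoord e'.2 e.1.1 = 0 /\ xcoord e'.2 e.1.2 = 0.
Proof.
by rewrite !inE => /or4P[]/eqP-> /or4P[]/eqP->; rewrite /= !xcoordE.
Qed.

Definition L_5_8 : vectLieType F := table_algebra (LieTable nil2_5_8).
Definition L_6_22 (eps : F) : vectLieType F :=
  table_algebra (LieTable (@nil2_6_22 eps)).
Definition L_6_7_2 (eta : F) : vectLieType F :=
  table_algebra (LieTable (@nil2_6_7_2 eta)).
Definition L_1 : vectLieType F := table_algebra (LieTable nil2_1).

End NamedAlgebras.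

(* Main.v *)
Require Import Defs.
From HB Require Import structures.
From mathcomp Require Import all_boot all_order all_algebra.
From mathcomp Require Import boolp classical_sets.
From mathcomp Require Import ring zify.

(** Let H be of class two, V = H / H^2 and W = H^2 = Z(H).  In H (x) H the
    defining relations imply, in every characteristic, w (x) v = - v (x) w for w
    in W, and the cyclic identity
      a (x) [b, c] + b (x) [c, a] + c (x) [a, b] = 0
    (lemmas [pair_lie_skew] and [pair_jacobi]); moreover W (x) W = 0, so that both
    squares are abelian.  Conversely these consequences exhaust the relations:
    choosing a complement of W in H, one gets
      H (x) H = (V (x) V) + (V (x) W) / J,  H /\ H = Lambda^2 V + (V (x) W) / J,
    as direct sums of vector spaces, where J is the span of the cyclic sums
    (theorems [tensor_square_iso] and [exterior_square_iso]).  The isomorphism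
    type therefore depends only on m = dim V = n - 2 and on the dimension d of
    (V (x) W) / J, the [jacobi_corank].

    If H is not capable, then Z^(H) <> 0.  Indeed H x (H /\ H) with the bracket
    [(a, x), (b, y)] = ([a, b], a /\ b) is a Lie algebra, and when Z^(H) = 0 its
    center is the second factor, so H would be capable
    ([exterior_center0_capable]).  Also Z^(H) is contained in W.  If Z^(H) = W then
    all of V (x) W is in J and d = 0 ([full_jacobi_corank]).  Otherwise Z^(H) is a
    line, and the bracket modulo this line is a scalar form on V; its rank must be
    2, as a larger rank would put V (x) W in J, and then d = 2
    ([rank_one_corank]).  The algebras of the second part are handled by explicit
    elimination in the 2 m matrix units of V (x) W, with d = 5, 4, 4 and 1. *)

Set Implicit Arguments.
Unset Strict Implicit.
Unset Printing Implicit Defensive.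

Import GRing.Theory.
Local Open Scope ring_scope.

(** * Linear maps and linear spans *)

Lemma linear_ex (F : fieldType) (U V : lmodType F) (f : U -> V) :
  linear f -> exists g : {linear U -> V}, g =1 f.
Proof.
move=> f_lin; pose fL := GRing.isLinear.Build F U V *:%R f f_lin.
by exists (HB.pack_for {linear U -> V} f fL).
Qed.

Lemma inj_surj_bij (T U : Type) (f : T -> U) :
  injective f -> (forall y, exists x, f x = y) -> bijective f.
Proof.
move=> f_inj f_surj; pose g y := sval (cid (f_surj y)).
have gK : cancel g f by move=> y; rewrite /g; case: cid.
by exists g => // x; apply: f_inj; rewrite gK.
Qed.

Section LinSpan.
Variables (F : fieldType) (V : lmodType F).
Implicit Types (A : set V) (v : V).

Lemma lin_span_gen A v : A v -> lin_span A v.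
Proof.
move=> Av; exists [:: (1, v)]; rewrite big_seq1 scale1r; split=> //.
by move=> p; rewrite inE => /eqP ->.
Qed.

Lemma lin_span0 A : lin_span A 0.
Proof. by exists [::]; rewrite big_nil. Qed.

Lemma lin_spanD A u v : lin_span A u -> lin_span A v -> lin_span A (u + v).
Proof.
move=> [s [sA ->]] [t [tA ->]]; exists (s ++ t); rewrite big_cat; split=> // p.
by rewrite mem_cat => /orP[/sA|/tA].
Qed.

Lemma lin_spanZ A c v : lin_span A v -> lin_span A (c *: v).
Proof.
move=> [s [sA ->]]; exists [seq (c * p.1, p.2) | p <- s]; split.
  by move=> _ /mapP[p /sA Ap ->].
by rewrite big_map scaler_sumr; apply: eq_bigr => p _ /=; rewrite scalerA.
Qed.

Lemma lin_spanN A v : lin_span A v -> lin_span A (- v).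
Proof. by rewrite -scaleN1r; apply: lin_spanZ. Qed.

Lemma lin_span_sum A (I : Type) (r : seq I) (f : I -> V) :
  (forall i, lin_span A (f i)) -> lin_span A (\sum_(i <- r) f i).
Proof.
move=> Af; elim/big_ind: _ => //; [exact: lin_span0 | exact: lin_spanD].
Qed.

Lemma lin_span_ind A (P : V -> Prop) :
    P 0 -> (forall u v, P u -> P v -> P (u + v)) ->
    (forall c v, P v -> P (c *: v)) -> (forall v, A v -> P v) ->
  forall v, lin_span A v -> P v.
Proof.
move=> P0 PD PZ PA _ [s [sA ->]]; elim: s sA => [|p s IHs] sA.
  by rewrite big_nil.
rewrite big_cons; apply: PD; first exact/PZ/PA/sA/mem_head.
by apply: IHs => q qs; apply: sA; rewrite inE qs orbT.
Qed.

Lemma eq_linear_span (W : lmodType F) A (f g : {linear V -> W}) v :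
  (forall u, A u -> f u = g u) -> lin_span A v -> f v = g v.
Proof.
move=> fgA; move: v; apply: lin_span_ind => [|u v fu fv|c v fv|//].
- by rewrite !linear0.
- by rewrite !linearD fu fv.
- by rewrite !linearZ fv.
Qed.

End LinSpan.

(** A subspace of largest dimension among those contained in the span of A must
    contain A. *)
Lemma lin_span_vspace (F : fieldType) (V : vectType F) (A : set V) :
  exists U : {vspace V}, forall v, v \in U <-> lin_span A v.
Proof.
pose P d := `[< exists U : {vspace V},
                \dim U = d /\ forall v, v \in U -> lin_span A v >].
have exP : exists d, P d.
  exists 0%N; apply/asboolP; exists 0%VS; rewrite dimv0; split=> // v.
  by rewrite memv0 => /eqP ->; apply: lin_span0.
have ubP d : P d -> (d <= \dim {:V})%N.
  by move=> /asboolP[U [<- _]]; apply/dimvS/subvf.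
case: (ex_maxnP exP ubP) => d /asboolP[U [dU UA]] maxU.
exists U => v; split=> [/UA //|]; move: v.
apply: lin_span_ind => [|u v|c v|v Av]; [exact: mem0v | exact: memvD | exact: memvZ |].
have -> : U = (U + <[v]>)%VS; last by rewrite (subvP (addvSr _ _)) ?memv_line.
apply/eqP; rewrite eqEdim addvSl dU; apply: maxU; apply/asboolP.
exists (U + <[v]>)%VS; split=> // _ /memv_addP[u uU [_ /vlineP[c ->] ->]].
exact/lin_spanD/lin_spanZ/lin_span_gen/Av/UA.
Qed.

(** * Lie pairings and the universal properties of the squares *)

Section Pairing.
Variables (F : fieldType) (L : lieAlgType F).

(** Bilinearity and the two defining relations of the tensor square that do not
    involve its own bracket.  The third relation becomes a vanishing condition for
    abelian targets, which the lifting lemmas below take as a hypothesis. *)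
Record lie_pairing (A : lmodType F) (t : L -> L -> A) : Prop := LiePairing {
  pairDl : forall a a' b, t (a + a') b = t a b + t a' b;
  pairZl : forall c a b, t (c *: a) b = c *: t a b;
  pairDr : forall a b b', t a (b + b') = t a b + t a b';
  pairZr : forall c a b, t a (c *: b) = c *: t a b;
  pair_liel : forall a a' b, t (lie a a') b = t a (lie a' b) - t a' (lie a b);
  pair_lier : forall a b b', t a (lie b b') = t (lie b' a) b - t (lie b a) b'
}.

Lemma tens_pairing : lie_pairing (@tens F L).
Proof.
split=> *; rewrite /tens -?lie_classN -?lie_classD -?lie_classZ;
  apply/(@lie_classP F (tensor_setoid L)).
- exact: teq_genDl.
- exact: teq_genZl.
- exact: teq_genDr.
- exact: teq_genZr.
- exact: teq_gen_liel.
- exact: teq_gen_lier.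
Qed.

Lemma wedge_pairing : lie_pairing (@wedge F L).
Proof.
have [Dl Zl Dr Zr ll lr] := tens_pairing.
split=> *; rewrite /wedge /coset_by.
- by rewrite Dl; apply: (@lie_classD F (ideal_setoid (box_ideal L))).
- by rewrite Zl; apply: (@lie_classZ F (ideal_setoid (box_ideal L))).
- by rewrite Dr; apply: (@lie_classD F (ideal_setoid (box_ideal L))).
- by rewrite Zr; apply: (@lie_classZ F (ideal_setoid (box_ideal L))).
- rewrite ll (@lie_classD F (ideal_setoid (box_ideal L))).
  by congr (_ + _); apply: (@lie_classN F (ideal_setoid (box_ideal L))).
- rewrite lr (@lie_classD F (ideal_setoid (box_ideal L))).
  by congr (_ + _); apply: (@lie_classN F (ideal_setoid (box_ideal L))).
Qed.

Lemma wedge_alt (a : L) : wedge a a = 0.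
Proof.
apply/(@lie_classP F (ideal_setoid (box_ideal L))).
rewrite /= /ideal_eq subr0; apply: lin_span_gen.
by exists a.
Qed.

Lemma wedge_lie (a b a' b' : L) :
  lie (wedge a b) (wedge a' b') = - wedge (lie b a) (lie a' b').
Proof.
rewrite /wedge /coset_by -lie_classN -lie_class_lie.
by congr (lie_class _); apply: tens_lie.
Qed.

Lemma wedgeC (a b : L) : wedge a b = - wedge b a.
Proof.
have wP := wedge_pairing; have := wedge_alt (a + b).
rewrite (pairDl wP) !(pairDr wP) !wedge_alt add0r addr0.
by move/eqP; rewrite addr_eq0 => /eqP.
Qed.

Section PairingTheory.
Variables (A : lmodType F) (t : L -> L -> A).
Hypothesis tP : lie_pairing t.

Lemma pairNr a b : t a (- b) = - t a b.
Proof. by have := pairZr tP (-1) a b; rewrite !scaleN1r. Qed.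

Lemma pairNl a b : t (- a) b = - t a b.
Proof. by have := pairZl tP (-1) a b; rewrite !scaleN1r. Qed.

Lemma pair0l b : t 0 b = 0.
Proof. by have := pairZl tP 0 0 b; rewrite !scale0r. Qed.

Lemma pair0r a : t a 0 = 0.
Proof. by have := pairZr tP 0 a 0; rewrite !scale0r. Qed.

Lemma pair_suml (I : Type) (r : seq I) (f : I -> L) b :
  t (\sum_(i <- r) f i) b = \sum_(i <- r) t (f i) b.
Proof. by rewrite (big_morph (t^~ b) (fun x y => pairDl tP x y b) (pair0l b)). Qed.

Lemma pair_sumr (I : Type) (r : seq I) (f : I -> L) a :
  t a (\sum_(i <- r) f i) = \sum_(i <- r) t a (f i).
Proof. by rewrite (big_morph (t a) (pairDr tP a) (pair0r a)). Qed.

Let cyc a b c := t a (lie b c) + t b (lie c a) + t c (lie a b).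

Let pair_swap a b c : t (lie a b) c = cyc a b c - t c (lie a b).
Proof. by rewrite /cyc addrK (pair_liel tP) (lieC a c) pairNr opprK. Qed.

Let cycC a b c : cyc b c a = cyc a b c.
Proof. by rewrite /cyc addrC addrA. Qed.

(** Expanding [a, b] (x) c by the first relation gives
    [a, b] (x) c + c (x) [a, b] = S, with S the cyclic sum, and expanding
    c (x) [a, b] by the second one and then the first gives
    c (x) [a, b] = 2 S - (S - c (x) [a, b]).  So S = 0 in any
    characteristic. *)
Lemma pair_jacobi a b c :
  t a (lie b c) + t b (lie c a) + t c (lie a b) = 0.
Proof.
have := pair_lier tP c a b; rewrite (lieC a c) pairNl opprK !pair_swap.
rewrite (cycC a b c) -(cycC c a b) addrACA -opprD -addrA.
have -> : cyc a b c - (t a (lie b c) + t b (lie c a)) = t c (lie a b).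
  by rewrite /cyc addrAC subrr add0r.
by rewrite -[LHS]add0r => /addIr/esym.
Qed.

Lemma pair_lie_skew a b c : t (lie a b) c = - t c (lie a b).
Proof. by rewrite pair_swap /cyc pair_jacobi sub0r. Qed.

Lemma pair_derived_skew w c : derived L w -> t w c = - t c w.
Proof.
move: w; apply: lin_span_ind => [|u v uS vS|k v vS|_ [a [b ->]]].
- by rewrite pair0l pair0r oppr0.
- by rewrite (pairDl tP) (pairDr tP) opprD uS vS.
- by rewrite (pairZl tP) (pairZr tP) vS scalerN.
- exact: pair_lie_skew.
Qed.

Lemma pair_lie_central a b c : center L c -> t (lie a b) c = 0.
Proof.
by move=> cZ; rewrite (pair_liel tP) 2![lie _ c]lieC !cZ !oppr0 !pair0r subrr.
Qed.

(** In class two, where H^2 is central, this says that H^2 (x) H^2 = 0; the third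
    defining relation then makes the squares abelian. *)
Lemma pair_derived_central w c : derived L w -> center L c -> t w c = 0.
Proof.
move=> wD cZ; move: w wD; apply: lin_span_ind => [|u v u0 v0|k v v0|_ [a [b ->]]].
- exact: pair0l.
- by rewrite (pairDl tP) u0 v0 addr0.
- by rewrite (pairZl tP) v0 scaler0.
- exact: pair_lie_central.
Qed.

End PairingTheory.

(** The generators span linearly, and not only as a Lie algebra, because the
    bracket of two generators is again a generator up to sign. *)
Lemma tensor_span (u : tensor_square L) :
  lin_span [set z | exists a b : L, z = tens a b] u.
Proof.
elim/(@lie_quotientP F (tensor_setoid L)): u.
elim=> [a b||u IHu|u IHu v IHv|c u IHu|u IHu v IHv].
- by apply: lin_span_gen; exists a, b.
- exact: lin_span0.
- by rewrite (@lie_classN F (tensor_setoid L)); apply: lin_spanN.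
- by rewrite (@lie_classD F (tensor_setoid L)); apply: lin_spanD.
- by rewrite (@lie_classZ F (tensor_setoid L)); apply: lin_spanZ.
rewrite (@lie_class_lie F (tensor_setoid L)).
move: (lie_class _) IHu => {}u IHu; move: (lie_class _) IHv => {}v IHv.
move: u IHu; apply: lin_span_ind => [|u u' uS u'S|c u uS|_ [a [b ->]]].
- by rewrite lie0l; apply: lin_span0.
- by rewrite lieDl; apply: lin_spanD.
- by rewrite lieZl; apply: lin_spanZ.
move: v IHv; apply: lin_span_ind => [|v v' vS v'S|c v vS|_ [a' [b' ->]]].
- by rewrite lie0r; apply: lin_span0.
- by rewrite lieDr; apply: lin_spanD.
- by rewrite lieZr; apply: lin_spanZ.
by rewrite tens_lie; apply/lin_spanN/lin_span_gen; exists (lie b a), (lie a' b').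
Qed.

Lemma coset_surj (I : lie_ideal (tensor_square L)) (u : quotient_by I) :
  exists x, u = coset_by I x.
Proof. by exists (lie_repr u); rewrite /coset_by lie_reprK. Qed.

Lemma wedge_span (u : exterior_square L) :
  lin_span [set z | exists a b : L, z = wedge a b] u.
Proof.
have [x ->] := coset_surj u.
move: x (tensor_span x); apply: lin_span_ind => [|x y xS yS|c x xS|_ [a [b ->]]].
- exact: lin_span0.
- by rewrite /coset_by (@lie_classD F (ideal_setoid (box_ideal L))); apply: lin_spanD.
- by rewrite /coset_by (@lie_classZ F (ideal_setoid (box_ideal L))); apply: lin_spanZ.
- by apply: lin_span_gen; exists a, b.
Qed.

Section Lift.
Variables (A : lmodType F) (t : L -> L -> A).
Hypotheses (tP : lie_pairing t)
  (tll : forall a b a' b', t (lie a b) (lie a' b') = 0).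

Fixpoint word_value (u : tensor_word L) : A :=
  match u with
  | TGen a b => t a b
  | TZero => 0
  | TOpp u => - word_value u
  | TAdd u v => word_value u + word_value v
  | TScale c u => c *: word_value u
  | TLie _ _ => 0
  end.

Lemma word_value_eq u v : tensor_eq u v -> word_value u = word_value v.
Proof.
elim=> //= *; try congruence.
- exact: addrA.
- exact: addrC.
- exact: add0r.
- exact: addNr.
- exact: scalerA.
- exact: scale1r.
- exact: scalerDr.
- exact: scalerDl.
- by rewrite addr0.
- by rewrite scaler0.
- by rewrite addr0.
- by rewrite scaler0.
- by rewrite !addr0.
- exact: pairDl.
- exact: pairZl.
- exact: pairDr.
- exact: pairZr.
- exact: pair_liel.
- exact: pair_lier.
- by rewrite tll oppr0.
Qed.

(** Universal property of the tensor square for targets regarded as abelian Lie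
    algebras: brackets are sent to 0, which [tll] makes compatible with the third
    relation. *)
Lemma tensor_lift :
  exists f : {linear tensor_square L -> A}, forall a b, f (tens a b) = t a b.
Proof.
pose f (u : tensor_square L) := word_value (lie_repr u).
have fE x : f (lie_class x) = word_value x.
  exact: (word_value_eq (@lie_repr_class F (tensor_setoid L) x)).
have [|g gE] := @linear_ex F (tensor_square L) A f; last first.
  by exists g => a b; rewrite gE fE.
move=> c; elim/(@lie_quotientP F (tensor_setoid L)) => x.
elim/(@lie_quotientP F (tensor_setoid L)) => y.
by rewrite -lie_classZ -lie_classD !fE.
Qed.

Lemma exterior_lift : (forall a, t a a = 0) ->
  exists f : {linear exterior_square L -> A}, forall a b, f (wedge a b) = t a b.
Proof.
move=> taa; have [f fE] := tensor_lift.
have f_box x : box_square L x -> f x = 0.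
  move: x; apply: lin_span_ind => [|u v u0 v0|c u u0|_ [a ->]].
  - exact: linear0.
  - by rewrite linearD u0 v0 addr0.
  - by rewrite linearZ /= u0 scaler0.
  - by rewrite fE taa.
pose g (u : exterior_square L) := f (lie_repr u).
have gE x : g (coset_by (box_ideal L) x) = f x.
  have := @lie_repr_class F (ideal_setoid (box_ideal L)) x.
  by move/f_box; rewrite linearB => /eqP; rewrite subr_eq0 => /eqP.
have [|h hE] := @linear_ex F (exterior_square L) A g; last first.
  by exists h => a b; rewrite hE gE.
move=> c u v; have [x ->] := coset_surj u; have [y ->] := coset_surj v.
rewrite /coset_by -lie_classZ -lie_classD -/(coset_by _ _) !gE.
exact: linearP.
Qed.
End Lift.

End Pairing.

(** * Class two: the model of the squares *)

Lemma abelian_iso (F : fieldType) (E : lieAlgType F) d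
    (f : {linear E -> 'rV[F]_d}) :
  (forall u v : E, lie u v = 0) -> bijective f ->
  lie_isomorphic E (abelian_lie F d).
Proof.
move=> lie0 f_bij; exists (f : {linear E -> abelian_lie F d}).
by split=> // x y; rewrite lie0 linear0.
Qed.

(** Linear coordinates on a Lie algebra H of class two: [vp] is the projection to
    V = H / H^2 = F^m, and [wp] gives the component along H^2 = F^r relative to
    the complement of H^2 on which it vanishes.  Recording the two coordinate maps,
    rather than subspaces and bases, makes a frame easy to pull back along an
    isomorphism. *)
Record frame (F : fieldType) (H : lieAlgType F) m r := Frame {
  vp : {linear H -> 'rV[F]_m};
  wp : {linear H -> 'rV[F]_r};
  frame_inj : forall h, vp h = 0 -> wp h = 0 -> h = 0;
  frame_surj : forall x y, exists h, vp h = x /\ wp h = y;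
  frame_derived : forall h, derived H h <-> vp h = 0;
  frame_central : forall h, derived H h -> center H h
}.

Section Frame.
Variables (F : fieldType) (H : lieAlgType F) (m r : nat) (fr : frame H m r).
Local Notation vp := (vp fr).
Local Notation wp := (wp fr).
Implicit Types a b c h w : H.

Lemma derived_lie a b : derived H (lie a b).
Proof. by apply: lin_span_gen; exists a, b. Qed.

Lemma vp_lie a b : vp (lie a b) = 0.
Proof. exact/(frame_derived fr)/derived_lie. Qed.

Lemma lie_lie a b c : lie a (lie b c) = 0.
Proof. by rewrite lieC (frame_central fr (derived_lie b c)) oppr0. Qed.

Lemma frame_eq h h' : vp h = vp h' -> wp h = wp h' -> h = h'.
Proof.
move=> vE wE; apply/eqP; rewrite -subr_eq0; apply/eqP.
by apply: (frame_inj (f := fr)); rewrite linearB ?vE ?wE subrr.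
Qed.

Definition frame_elt x y : H := sval (cid (frame_surj fr x y)).

Lemma vp_elt x y : vp (frame_elt x y) = x.
Proof. by rewrite /frame_elt; case: cid => h []. Qed.

Lemma wp_elt x y : wp (frame_elt x y) = y.
Proof. by rewrite /frame_elt; case: cid => h []. Qed.

Definition vb i : H := frame_elt (delta_mx 0 i) 0.
Definition wb k : H := frame_elt 0 (delta_mx 0 k).

Lemma derived_wb k : derived H (wb k).
Proof. by apply/(frame_derived fr); rewrite vp_elt. Qed.

Lemma frame_sum h :
  h = \sum_i vp h 0 i *: vb i + \sum_k wp h 0 k *: wb k.
Proof.
apply: frame_eq; rewrite linearD !linear_sum /=.
  rewrite [X in _ + X]big1 => [|k _]; last by rewrite linearZ /= vp_elt scaler0.
  rewrite addr0 {1}[vp h]row_sum_delta.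
  by apply: eq_bigr => i _; rewrite linearZ /= vp_elt.
rewrite [X in X + _]big1 => [|k _]; last by rewrite linearZ /= wp_elt scaler0.
rewrite add0r {1}[wp h]row_sum_delta.
by apply: eq_bigr => i _; rewrite linearZ /= wp_elt.
Qed.

(** In the model, V (x) H^2 is the space of m x r matrices, v (x) w being the
    matrix v^T w.  Since w (x) v = - v (x) w in any Lie pairing, this is the mixed
    part of a (x) b. *)
Definition cross a b : 'M[F]_(m, r) :=
  (vp a)^T *m wp b - (vp b)^T *m wp a.

(** The elements of V (x) H^2 that every Lie pairing kills, by [pair_jacobi]. *)
Definition jac a b c : 'M[F]_(m, r) :=
  (vp a)^T *m wp (lie b c) + (vp b)^T *m wp (lie c a) + (vp c)^T *m wp (lie a b).

Definition jacobians : set 'M[F]_(m, r) :=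
  [set N | exists a b c, N = jac a b c].

(** The quotient of V (x) H^2 by the span J of the cyclic sums has dimension d.
    The quotient map [p] and a linear section [s] are part of the statement, since
    the isomorphisms are written in terms of them. *)
Definition jacobi_corank d : Prop :=
  exists (p : {linear 'M[F]_(m, r) -> 'rV[F]_d})
         (s : {linear 'rV[F]_d -> 'M[F]_(m, r)}),
  [/\ forall q, p (s q) = q, forall a b c, p (jac a b c) = 0
    & forall N, lin_span jacobians (N - s (p N))].

Lemma cross_lier a b c : cross a (lie b c) = (vp a)^T *m wp (lie b c).
Proof. by rewrite /cross vp_lie trmx0 mul0mx subr0. Qed.

Lemma cross_liel a b c : cross (lie b c) a = - ((vp a)^T *m wp (lie b c)).
Proof. by rewrite /cross vp_lie trmx0 mul0mx sub0r. Qed.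

Section Pairings.
Variables (A : lmodType F) (t : H -> H -> A).
Hypothesis tP : lie_pairing t.

Definition central_sum (N : 'M[F]_(m, r)) : A :=
  \sum_i \sum_k N i k *: t (vb i) (wb k).

Fact central_sum_linear : linear central_sum.
Proof.
move=> c M N; rewrite /central_sum scaler_sumr -big_split; apply: eq_bigr => i _.
rewrite scaler_sumr -big_split; apply: eq_bigr => k _ /=.
by rewrite !mxE scalerDl scalerA.
Qed.
HB.instance Definition _ :=
  GRing.isLinear.Build F 'M[F]_(m, r) A *:%R central_sum central_sum_linear.

Lemma pair_derived_sum a w : derived H w ->
  t a w = \sum_k wp w 0 k *: t a (wb k).
Proof.
move=> /(frame_derived fr) w0; rewrite {1}[w]frame_sum w0.
rewrite [X in t a (X + _)]big1 => [|i _]; last by rewrite mxE scale0r.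
rewrite add0r (pair_sumr tP); apply: eq_bigr => k _; exact: pairZr.
Qed.

(** Elements of H^2 pair to zero, so t a w depends only on the class of a
    modulo H^2. *)
Lemma pair_derivedE a w : derived H w ->
  t a w = \sum_i vp a 0 i *: t (vb i) w.
Proof.
move=> wD; rewrite {1}[a]frame_sum (pairDl tP) !(pair_suml tP).
rewrite [X in _ + X]big1 => [|k _]; last first.
  rewrite (pairZl tP) (pair_derived_central tP) ?scaler0 //.
    exact: derived_wb.
  exact: (frame_central fr).
by rewrite addr0; apply: eq_bigr => i _; rewrite (pairZl tP).
Qed.

(** A linear map out of V (x) H^2 that represents t on mixed arguments is thus
    available for every Lie pairing t; it factors through the quotient by J. *)
Lemma central_sum_outer a w : derived H w ->
  central_sum ((vp a)^T *m wp w) = t a w.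
Proof.
move=> wD; rewrite (pair_derivedE a wD); apply: eq_bigr => i _.
rewrite (pair_derived_sum (vb i) wD) scaler_sumr; apply: eq_bigr => k _.
by rewrite scalerA mxE big_ord1 mxE.
Qed.

Lemma central_sum_jac a b c : central_sum (jac a b c) = 0.
Proof.
rewrite /jac !linearD /= !central_sum_outer; try exact: derived_lie.
exact: pair_jacobi.
Qed.

Lemma central_sum_span N : lin_span jacobians N -> central_sum N = 0.
Proof.
move: N; apply: lin_span_ind => [|M N M0 N0|c N N0|_ [a [b [c ->]]]].
- exact: linear0.
- by rewrite linearD /= M0 N0 addr0.
- by rewrite linearZ /= N0 scaler0.
- exact: central_sum_jac.
Qed.

(** Split a and b into their components in V and H^2: the component in
    H^2 (x) H^2 vanishes and the two mixed ones combine into [cross]. *)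
Lemma pair_decomp a b :
  t a b = \sum_i \sum_j (vp a 0 i * vp b 0 j) *: t (vb i) (vb j)
          + central_sum (cross a b).
Proof.
pose v h := \sum_i vp h 0 i *: vb i; pose w h := \sum_k wp h 0 k *: wb k.
have hE h : h = v h + w h := frame_sum h.
have vpv h : vp (v h) = vp h.
  rewrite {1}[vp h]row_sum_delta linear_sum; apply: eq_bigr => i _.
  by rewrite linearZ /= vp_elt.
have wpw h : wp (w h) = wp h.
  rewrite {1}[wp h]row_sum_delta linear_sum; apply: eq_bigr => i _.
  by rewrite linearZ /= wp_elt.
have wD h : derived H (w h).
  apply/(frame_derived fr); rewrite linear_sum big1 // => k _.
  by rewrite linearZ /= vp_elt scaler0.
rewrite {1}[a]hE {1}[b]hE (pairDl tP) !(pairDr tP).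
rewrite [t (w a) (w b)](pair_derived_central tP) //; last exact: (frame_central fr).
rewrite addr0 -addrA; congr (_ + _).
  rewrite (pair_suml tP); apply: eq_bigr => i _; rewrite (pair_sumr tP).
  by apply: eq_bigr => j _; rewrite (pairZl tP) (pairZr tP) scalerA.
have vwE x y : t (v x) (w y) = central_sum ((vp x)^T *m wp y).
  by rewrite -(central_sum_outer (v x) (wD y)) vpv wpw.
by rewrite (pair_derived_skew tP (v b) (wD a)) !vwE -linearB.
Qed.
End Pairings.

(** The converse of [pair_jacobi]: once the cyclic sums are killed, the mixed part
    alone satisfies both relations, because [lie a b] has no component in V. *)
Lemma cross_pairing (A : lmodType F) (p : {linear 'M[F]_(m, r) -> A}) :
  (forall a b c, p (jac a b c) = 0) -> lie_pairing (fun a b => p (cross a b)).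
Proof.
move=> pJ.
have crossC a b : cross b a = - cross a b by rewrite /cross opprB.
have Dl a a' b : cross (a + a') b = cross a b + cross a' b.
  by rewrite /cross !linearD /= mulmxDl ?opprD addrACA.
have Zl (c : F) a b : cross (c *: a) b = c *: cross a b.
  rewrite /cross scalerBr; congr (_ - _); last by rewrite linearZ /= scalemxAr.
  by rewrite linearZ /= linearZ /= scalemxAl.
have pN a b c :
    p ((vp a)^T *m wp (lie b c)) = - p ((vp a)^T *m wp (lie c b)).
  by rewrite lieC linearN mulmxN linearN.
split=> [*|*|*|*|a a' b|a b b'].
- by rewrite Dl linearD.
- by rewrite Zl linearZ.
- by rewrite crossC Dl opprD -!crossC linearD.
- by rewrite crossC Zl -scalerN -crossC linearZ.
- rewrite cross_liel !cross_lier linearN (pN a' a b) opprK; apply/esym/eqP.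
  by rewrite -addr_eq0 -!linearD /= -(pJ a a' b).
- rewrite cross_lier !cross_liel !linearN (pN b' b a) opprK -opprD; apply/eqP.
  by rewrite -addr_eq0 addrA -!linearD /= -(pJ a b b').
Qed.

(** On V the relations are void: they only involve brackets, which project to 0. *)
Lemma quad_pairing (A : lmodType F) (q : 'rV[F]_m -> 'rV[F]_m -> A) :
    (forall y, linear (q^~ y)) -> (forall x, linear (q x)) ->
  lie_pairing (fun a b => q (vp a) (vp b)).
Proof.
move=> ql qr.
have ql0 y : q 0 y = 0.
  by have := ql y (-1) 0 0; rewrite scaler0 addr0 scaleN1r addNr.
have qr0 x : q x 0 = 0.
  by have := qr x (-1) 0 0; rewrite scaler0 addr0 scaleN1r addNr.
split=> [a a' b|c a b|a b b'|c a b|a a' b|a b b'].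
- by have := ql (vp b) 1 (vp a) (vp a'); rewrite !scale1r linearD.
- by have := ql (vp b) c (vp a) 0; rewrite ql0 !addr0 linearZ.
- by have := qr (vp a) 1 (vp b) (vp b'); rewrite !scale1r linearD.
- by have := qr (vp a) c (vp b) 0; rewrite qr0 !addr0 linearZ.
- by rewrite !vp_lie ql0 !qr0 subrr.
- by rewrite !vp_lie !ql0 !qr0 subrr.
Qed.

(** Both squares are treated at once.  E stands for either of them, with
    generators [t a b], and [q] for the projection of V (x) V onto its image in E
    (everything for the tensor square, Lambda^2 V for the exterior one), a space
    with basis indexed by the pairs [ix l] of basis vectors of V. *)
Section Square.
Variables (k d : nat) (q : 'rV[F]_m -> 'rV[F]_m -> 'rV[F]_k).
Hypotheses (ql : forall y, linear (q^~ y)) (qr : forall x, linear (q x)).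
Variables (p : {linear 'M[F]_(m, r) -> 'rV[F]_d}).
Hypothesis pJ : forall a b c, p (jac a b c) = 0.

Let model a b : 'rV[F]_(k + d) := row_mx (q (vp a) (vp b)) (p (cross a b)).

Lemma model_pairing : lie_pairing model.
Proof.
have [Dl1 Zl1 Dr1 Zr1 ll1 lr1] := quad_pairing ql qr.
have [Dl2 Zl2 Dr2 Zr2 ll2 lr2] := cross_pairing pJ.
split=> *; rewrite /model.
- by rewrite Dl1 Dl2 add_row_mx.
- by rewrite Zl1 Zl2 scale_row_mx.
- by rewrite Dr1 Dr2 add_row_mx.
- by rewrite Zr1 Zr2 scale_row_mx.
- by rewrite ll1 ll2 opp_row_mx add_row_mx.
- by rewrite lr1 lr2 opp_row_mx add_row_mx.
Qed.

Lemma model_lie_lie a b a' b' : model (lie a b) (lie a' b') = 0.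
Proof.
apply: (pair_derived_central model_pairing); first exact: derived_lie.
exact/(frame_central fr)/derived_lie.
Qed.

Variables (E : lieAlgType F) (t : H -> H -> E) (f : {linear E -> 'rV[F]_(k + d)}).
Hypotheses (tP : lie_pairing t)
  (t_span : forall u, lin_span [set z | exists a b, z = t a b] u)
  (t_lie : forall a b a' b', lie (t a b) (t a' b') = - t (lie b a) (lie a' b'))
  (fE : forall a b, f (t a b) = model a b).

Lemma square_abelian (u v : E) : lie u v = 0.
Proof.
move: u (t_span u); apply: lin_span_ind => [|x y x0 y0|c x x0|_ [a [b ->]]].
- exact: lie0l.
- by rewrite lieDl x0 y0 addr0.
- by rewrite lieZl x0 scaler0.
move: v (t_span v); apply: lin_span_ind => [|x y x0 y0|c x x0|_ [a' [b' ->]]].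
- exact: lie0r.
- by rewrite lieDr x0 y0 addr0.
- by rewrite lieZr x0 scaler0.
rewrite t_lie (pair_derived_central tP) ?oppr0 //; first exact: derived_lie.
exact/(frame_central fr)/derived_lie.
Qed.

Variables (s : {linear 'rV[F]_d -> 'M[F]_(m, r)}) (ix : 'I_k -> 'I_m * 'I_m).
Hypotheses (psK : forall z, p (s z) = z)
  (spK : forall N, lin_span jacobians (N - s (p N)))
  (q_delta : forall l, q (delta_mx 0 (ix l).1) (delta_mx 0 (ix l).2) = delta_mx 0 l)
  (q_sum : forall x y : 'rV[F]_m,
     \sum_i \sum_j (x 0 i * y 0 j) *: t (vb i) (vb j)
       = \sum_l q x y 0 l *: t (vb (ix l).1) (vb (ix l).2)).

(** The pairing [model] induces f : E -> F^(k + d).  Its inverse g sends a basis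
    vector of F^k to the generator with the indices [ix l], and F^d into E through
    the section s.  That g is a left inverse to f is [pair_decomp], where s (p N)
    may replace N because [central_sum] kills J. *)
Lemma square_iso : lie_isomorphic E (abelian_lie F (k + d)).
Proof.
pose g (z : 'rV[F]_(k + d)) : E :=
  \sum_l lsubmx z 0 l *: t (vb (ix l).1) (vb (ix l).2)
    + central_sum t (s (rsubmx z)).
have g_lin : linear g.
  move=> c y z; rewrite /g scalerDr addrACA; congr (_ + _); last by rewrite !linearP.
  rewrite scaler_sumr -big_split; apply: eq_bigr => l _ /=.
  by rewrite !mxE scalerDl scalerA.
have [G GE] := linear_ex g_lin.
have fg : cancel g f.
  move=> z; rewrite /g linearD !linear_sum /= -[RHS]hsubmxK.
  have -> : row_mx (lsubmx z) (rsubmx z) =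
      row_mx (lsubmx z) 0 + row_mx 0 (rsubmx z).
    by rewrite add_row_mx addr0 add0r.
  congr (_ + _).
    have -> : row_mx (lsubmx z) 0 =
        \sum_l lsubmx z 0 l *: row_mx (delta_mx 0 l) (0 : 'rV[F]_d).
      rewrite {1}[lsubmx z]row_sum_delta.
      rewrite (eq_bigr (fun l => row_mx (lsubmx z 0 l *: delta_mx 0 l) 0)).
        by elim/big_rec2: _ => [|l x y _ <-]; rewrite ?row_mx0 // add_row_mx addr0.
      by move=> l _; rewrite scale_row_mx scaler0.
    apply: eq_bigr => l _; rewrite linearZ /= fE /model !vp_elt q_delta.
    by rewrite /cross !wp_elt !mulmx0 subrr linear0.
  (* It remains to see that f (central_sum t N) = (0, p N), by linearity on the
     matrix units. *)
  rewrite -{2}[rsubmx z]psK; move: (s _) => N.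
  rewrite {2}[N]matrix_sum_delta linear_sum /=.
  have row0D (x y : 'rV[F]_d) : row_mx (0 : 'rV[F]_k) (x + y) = row_mx 0 x + row_mx 0 y.
    by rewrite add_row_mx addr0.
  rewrite (big_morph (row_mx (0 : 'rV[F]_k)) row0D (row_mx0 _ _ _ _)).
  apply: eq_bigr => i _; rewrite !linear_sum /=.
  rewrite (big_morph (row_mx (0 : 'rV[F]_k)) row0D (row_mx0 _ _ _ _)).
  apply: eq_bigr => j _; rewrite !linearZ /= fE /model /cross !vp_elt !wp_elt.
  have q0 x : q x 0 = 0.
    by have := qr x (-1) 0 0; rewrite scaler0 addr0 scaleN1r addNr.
  rewrite trmx0 mul0mx subr0 q0 -[X in _ = row_mx X _](scaler0 _ (N i j)).
  by rewrite -scale_row_mx trmx_delta mul_delta_mx.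
apply: (abelian_iso (f := f) square_abelian); exists g => // u.
rewrite -GE.
apply: (@eq_linear_span F E E _ (G \o f) idfun u _ (t_span u)).
move=> _ [a [b ->]] /=; rewrite GE fE /g row_mxKl row_mxKr.
rewrite [RHS](pair_decomp tP) -q_sum; congr (_ + _).
apply/eqP; rewrite eq_sym -subr_eq0 -linearB /= (central_sum_span tP) //.
Qed.

End Square.

End Frame.

Lemma card_ltn_pairs m : #|[pred ij : 'I_m * 'I_m | ij.1 < ij.2]%N| = 'C(m, 2).
Proof.
rewrite -bin2_sum big_mkord -sum1_card.
rewrite (eq_bigl (fun ij : 'I_m * 'I_m => true && (ij.1 < ij.2)%N)) //.
rewrite -(pair_big_dep xpredT (fun i j : 'I_m => i < j)%N (fun _ _ => 1%N)) /=.
rewrite (exchange_big_dep xpredT) //=; apply: eq_bigr => j _.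
rewrite -(big_ord_widen m (fun=> 1%N) (ltnW (ltn_ord j))).
by rewrite sum1_card card_ord.
Qed.

Section Squares.
Variables (F : fieldType) (H : lieAlgType F) (m r : nat) (fr : frame H m r).
Variables (d : nat).
Hypothesis frd : jacobi_corank fr d.

Theorem tensor_square_iso :
  lie_isomorphic (tensor_square H) (abelian_lie F (m ^ 2 + d)).
Proof.
have [p [s [psK pJ spK]]] := frd.
pose A := [pred ij : 'I_m * 'I_m | true].
have <- : #|A| = (m ^ 2)%N by rewrite -mulnn -[in RHS](card_ord m) -card_prod.
pose q (x y : 'rV[F]_m) : 'rV[F]_#|A| :=
  \row_l (x 0 (enum_val l).1 * y 0 (enum_val l).2).
have ql y : linear (q^~ y).
  by move=> c x x'; apply/rowP => l; rewrite !mxE mulrDl mulrA.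
have qr x : linear (q x).
  by move=> c y y'; apply/rowP => l; rewrite !mxE mulrDr mulrCA.
have mP := model_pairing ql qr pJ.
have [f fE] := tensor_lift mP (model_lie_lie ql qr pJ).
apply: (square_iso qr (tens_pairing H) (@tensor_span F H) _ fE psK spK
          (ix := @enum_val _ A)).
- exact: tens_lie.
- move=> l; apply/rowP => l'; rewrite !mxE -natrM mulnb /=.
  by rewrite -(inj_eq enum_val_inj) -pair_eqE.
- move=> x y; rewrite pair_big /=.
  under [RHS]eq_bigr do rewrite mxE.
  by rewrite -(big_enum_val (A := A) (fun ij => (x 0 ij.1 * y 0 ij.2)
      *: tens (vb fr ij.1) (vb fr ij.2))).
Qed.

Theorem exterior_square_iso :
  lie_isomorphic (exterior_square H) (abelian_lie F ('C(m, 2) + d)).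
Proof.
have [p [s [psK pJ spK]]] := frd.
rewrite -card_ltn_pairs; set A := [pred ij : 'I_m * 'I_m | _].
pose q (x y : 'rV[F]_m) : 'rV[F]_#|A| :=
  \row_l (x 0 (enum_val l).1 * y 0 (enum_val l).2
          - x 0 (enum_val l).2 * y 0 (enum_val l).1).
have ql y : linear (q^~ y).
  by move=> c x x'; apply/rowP => l; rewrite !mxE; ring.
have qr x : linear (q x).
  by move=> c y y'; apply/rowP => l; rewrite !mxE; ring.
have mP := model_pairing ql qr pJ.
have [|f fE] := exterior_lift mP (model_lie_lie ql qr pJ).
  have q_alt x : q x x = 0 by apply/rowP => l; rewrite !mxE mulrC subrr.
  by move=> a; rewrite q_alt /cross subrr linear0 row_mx0.
have wP := wedge_pairing H.
apply: (square_iso qr wP (@wedge_span F H) _ fE psK spK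
          (ix := @enum_val _ A)).
- exact: wedge_lie.
- move=> l; apply/rowP => l'; rewrite !mxE -!natrM !mulnb /=.
  have := enum_valP l; have := enum_valP l'; rewrite !inE.
  rewrite -[in RHS](inj_eq enum_val_inj) -[in RHS]pair_eqE /= => lt' lt.
  rewrite [X in _ - X](_ : _ = 0) ?subr0 //.
  case: andP => // -[/eqP e1 /eqP e2].
  by move: lt' lt; rewrite e1 e2 => /ltn_trans lt /lt; rewrite ltnn.
- move=> x y; rewrite pair_big /=.
  under [RHS]eq_bigr do rewrite mxE.
  rewrite -(big_enum_val (A := A) (fun ij => (x 0 ij.1 * y 0 ij.2 - x 0 ij.2 * y 0 ij.1)
      *: wedge (vb fr ij.1) (vb fr ij.2))) /=.
  (* Split the pairs into i < j, i = j and j < i; the diagonal vanishes, and the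
     last part is the first one with the indices exchanged. *)
  rewrite (bigID (mem A)) /=.
  rewrite [X in _ + X](bigID (fun ij : 'I_m * 'I_m => ij.1 == ij.2)) /=.
  rewrite [X in _ + (X + _)]big1 => [|[i j] /= /andP[_ /eqP ->]]; last first.
    by rewrite wedge_alt scaler0.
  rewrite add0r.
  rewrite [X in _ + X](reindex_inj (h := fun ij : 'I_m * 'I_m => (ij.2, ij.1))) /=.
    rewrite [X in _ + X](eq_bigl (mem A)) => [|[i j]]; last first.
      by rewrite !inE /= -leqNgt -val_eqE /= eq_sym ltn_neqAle andbC.
    rewrite -big_split; apply: eq_bigr => -[i j] _ /=.
    by rewrite (wedgeC (vb fr j)) scalerN scalerBl.
  by move=> [i j] [i' j'] [-> ->].
Qed.

End Squares.

(** * The exterior center and capability *)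

Section ExteriorCover.
Variables (F : fieldType) (L : lieAlgType F).

(** The central extension of L by its exterior square, with the cocycle
    (x, y) |-> x /\ y; the cocycle identity is [pair_jacobi]. *)
Definition exterior_cover : Type := (L * exterior_square L)%type.
HB.instance Definition _ := GRing.Lmodule.on exterior_cover.

Let wP : lie_pairing (@wedge F L) := wedge_pairing L.
Let cover_lie (u v : exterior_cover) : exterior_cover :=
  (lie u.1 v.1, wedge u.1 v.1).

Let cover_scaleE c (u : exterior_cover) :
  c *: u = (c *: u.1, c *: u.2) :> exterior_cover.
Proof. by []. Qed.

Fact cover_lieDl u v w : cover_lie (u + v) w = cover_lie u w + cover_lie v w.
Proof. by congr (_, _); [exact: (lieDl u.1 v.1 w.1) | exact: (pairDl wP u.1 v.1 w.1)]. Qed.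
Fact cover_lieZl c u v : cover_lie (c *: u) v = c *: cover_lie u v.
Proof. by rewrite !cover_scaleE /cover_lie lieZl (pairZl wP). Qed.
Fact cover_lieDr u v w : cover_lie u (v + w) = cover_lie u v + cover_lie u w.
Proof. by congr (_, _); [exact: (lieDr u.1 v.1 w.1) | exact: (pairDr wP u.1 v.1 w.1)]. Qed.
Fact cover_lieZr c u v : cover_lie u (c *: v) = c *: cover_lie u v.
Proof. by rewrite !cover_scaleE /cover_lie lieZr (pairZr wP). Qed.
Fact cover_liexx u : cover_lie u u = 0.
Proof. by congr (_, _); [exact: (liexx u.1) | exact: (wedge_alt u.1)]. Qed.
Fact cover_jacobi u v w : cover_lie u (cover_lie v w) + cover_lie v (cover_lie w u)
  + cover_lie w (cover_lie u v) = 0.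
Proof. by congr (_, _); [exact: (lie_jacobi u.1 v.1 w.1) | exact: (pair_jacobi wP u.1 v.1 w.1)]. Qed.

HB.instance Definition _ := isLieAlgebra.Build F exterior_cover
  cover_lieDl cover_lieZl cover_lieDr cover_lieZr cover_liexx cover_jacobi.

Lemma center_coverP (u : exterior_cover) :
  center exterior_cover u <-> center L u.1 /\ exterior_center L u.1.
Proof.
split=> [uZ|[uZ uW] v]; last by congr (_, _); [exact: uZ | exact: uW].
by split=> x; have := uZ (x, 0) => -[].
Qed.

(** An element (l, u) of the exterior cover is central only if l is in Z^(L), so
    when Z^(L) = 0 the center is the second factor and the quotient by it is L. *)
Theorem exterior_center0_capable :
  (forall l, exterior_center L l -> l = 0) -> capable L.
Proof.
move=> Z0; pose Q := quotient_by (center_ideal exterior_cover).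
have class_eq (u v : exterior_cover) :
    coset_by (center_ideal exterior_cover) u = coset_by (center_ideal exterior_cover) v
      <-> center exterior_cover (u - v).
  exact: (@lie_classP F (ideal_setoid (center_ideal exterior_cover)) u v).
pose f (x : L) : Q := coset_by (center_ideal exterior_cover) ((x, 0) : exterior_cover).
have f_lin : linear f.
  move=> c x y; rewrite /f /coset_by -lie_classZ -lie_classD.
  congr (lie_class _); congr (_, _); by rewrite /= scaler0 addr0.
have [g gE] := linear_ex f_lin.
exists exterior_cover, g; split; last first.
  move=> x y; rewrite !gE /f /coset_by -lie_class_lie.
  apply/class_eq/center_coverP; rewrite /= subrr.
  by split=> l; rewrite ?lie0l ?(pair0l wP).
apply: inj_surj_bij => [x y|u].
  rewrite !gE => /class_eq/center_coverP[_ /Z0 /eqP].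
  by rewrite subr_eq0 => /eqP.
exists (lie_repr u).1; rewrite gE -[RHS]lie_reprK.
apply/class_eq/center_coverP; rewrite /= subrr.
by split=> l; rewrite ?lie0l ?(pair0l wP).
Qed.

End ExteriorCover.

Section ExteriorCenter.
Variables (F : fieldType) (H : lieAlgType F) (m r : nat) (fr : frame H m r).

(** The bracket is an alternating Lie pairing, hence factors through the exterior
    square. *)
Lemma exterior_center_central l : exterior_center H l -> center H l.
Proof.
have lieP : lie_pairing (@lie F H).
  split; [exact: lieDl | exact: lieZl | exact: lieDr | exact: lieZr | |] => a b c.
    by rewrite [LHS]lieC !(lie_lie fr) oppr0 addr0.
  rewrite (lie_lie fr) [lie (lie c a) b]lieC [lie (lie b a) c]lieC.
  by rewrite !(lie_lie fr) !oppr0 addr0.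
have [|f fE] := exterior_lift lieP _ (@liexx F H).
  by move=> *; apply: (lie_lie fr).
by move=> lW x; rewrite -fE lW linear0.
Qed.

(** The exterior square maps onto V (x) H^2 / J, by a /\ w |-> class of a (x) w.
    The quotient is realized inside V (x) H^2 by the projection along J. *)
Lemma wedge_eq0_jacobian a w : derived H w ->
  wedge a w = 0 -> lin_span (jacobians fr) ((vp fr a)^T *m wp fr w).
Proof.
move=> wD aw0; have [J JE] := lin_span_vspace (jacobians fr).
have [|p pE] := @linear_ex F 'M[F]_(m, r) 'M[F]_(m, r) (fun N => N - projv J N).
  by move=> c M N; rewrite linearP scalerBr opprD addrACA.
have pJ b c e : p (jac fr b c e) = 0.
  rewrite pE projv_id ?subrr //; apply/JE/lin_span_gen.
  by exists b, c, e.
have cP := cross_pairing pJ.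
have [||f fE] := exterior_lift cP.
- move=> b c b' c'; apply: (pair_derived_central cP); first exact: derived_lie.
  exact/(frame_central fr)/derived_lie.
- by move=> b; rewrite /cross subrr linear0.
apply/JE; have := fE a w; rewrite aw0 linear0 /cross.
move/(frame_derived fr): wD => ->; rewrite trmx0 mul0mx subr0 pE => /esym/eqP.
by rewrite subr_eq0 => /eqP ->; apply: memv_proj.
Qed.

Lemma jacobian_wedge_eq0 a w : derived H w ->
  lin_span (jacobians fr) ((vp fr a)^T *m wp fr w) -> wedge a w = 0.
Proof.
have wP := wedge_pairing H; move=> wD /(central_sum_span (fr := fr) wP).
by rewrite (central_sum_outer fr wP).
Qed.

Lemma full_jacobi_corank : (forall a w, derived H w -> wedge a w = 0) ->
  jacobi_corank fr 0.
Proof.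
move=> w0.
have [p pE] : exists p : {linear 'M[F]_(m, r) -> 'rV[F]_0}, p =1 fun=> 0.
  by apply: linear_ex => c M N; rewrite scaler0 addr0.
have [s sE] : exists s : {linear 'rV[F]_0 -> 'M[F]_(m, r)}, s =1 fun=> 0.
  by apply: linear_ex => c M N; rewrite scaler0 addr0.
exists p, s; split=> [q|a b c|N]; rewrite ?pE; first by rewrite [RHS]thinmx0.
  by [].
rewrite sE subr0 [N]matrix_sum_delta.
apply: lin_span_sum => i; apply: lin_span_sum => k; apply: lin_spanZ.
have := wedge_eq0_jacobian (derived_wb fr k) (w0 (vb fr i) _ (derived_wb fr k)).
by rewrite vp_elt wp_elt trmx_delta mul_delta_mx.
Qed.

End ExteriorCenter.

(** * Non-capable generalized Heisenberg algebras of rank 2 *)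

(** A frame adapted to a prescribed basis of H^2, so that a line of H^2 can be
    made a coordinate axis. *)
Lemma heisenberg_frame (F : fieldType) (H : vectLieType F) (U : {vspace H}) r
    (Y : r.-tuple H) :
    derived H = center H -> [set x | x \in U]%classic = derived H ->
    basis_of U Y ->
  exists fr : frame H (\dim U^C) r, forall k : 'I_r, wp fr Y`_k = delta_mx 0 k.
Proof.
move=> dZ dU bY; pose X := vbasis U^C%VS; have bX := vbasisP U^C%VS.
have UC := capv_compl U.
pose pU := daddv_pi U U^C; pose pC := daddv_pi U^C U.
have UP h : derived H h <-> h \in U by rewrite -dU.
have pE h : pU h + pC h = h.
  by apply: daddv_pi_add; rewrite ?capv_compl // addv_complf memvf.
have pUU u : u \in U -> pU u = u /\ pC u = 0.
  move=> uU; have e : pU u = u by apply: daddv_pi_id.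
  by split=> //; apply: (addrI u); rewrite addr0 -{1}e pE.
have pCC u : u \in U^C%VS -> pU u = 0 /\ pC u = u.
  move=> uU; have e : pC u = u by apply: daddv_pi_id; rewrite 1?capvC.
  by split=> //; apply: (addIr u); rewrite add0r -{2}e pE.
have [v vE] : exists v : {linear H -> 'rV[F]_(\dim U^C)},
    v =1 fun h => \row_i coord X i (pC h).
  by apply: linear_ex => c a b; apply/rowP => i; rewrite !mxE !linearP.
have [w wE] : exists w : {linear H -> 'rV[F]_r},
    w =1 fun h => \row_k coord Y k (pU h).
  by apply: linear_ex => c a b; apply/rowP => k; rewrite !mxE !linearP.
have v0 h : v h = 0 -> pC h = 0.
  move=> vh; rewrite (coord_vbasis (memv_pi U^C%VS U h)) big1 // => i _.
  by have := congr1 (fun x : 'rV_ _ => x 0 i) vh; rewrite vE !mxE => ->; rewrite scale0r.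
have w0 h : w h = 0 -> pU h = 0.
  move=> wh; rewrite (coord_basis bY (memv_pi U U^C%VS h)) big1 // => i _.
  by have := congr1 (fun x : 'rV_ _ => x 0 i) wh; rewrite wE !mxE => ->; rewrite scale0r.
have vw_inj h : v h = 0 -> w h = 0 -> h = 0.
  by move=> /v0 e1 /w0 e2; rewrite -[h]pE e1 e2 addr0.
have vw_surj x y : exists h, v h = x /\ w h = y.
  pose a := \sum_i x 0 i *: X`_i; pose b := \sum_k y 0 k *: Y`_k.
  have aC : a \in U^C%VS.
    by apply: rpred_sum => i _; rewrite memvZ // (basis_mem bX) ?mem_nth ?size_tuple.
  have bU : b \in U.
    by apply: rpred_sum => i _; rewrite memvZ // (basis_mem bY) ?mem_nth ?size_tuple.
  have [a1 a2] := pCC _ aC; have [b1 b2] := pUU _ bU.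
  exists (a + b); split; apply/rowP => i; rewrite ?vE ?wE mxE linearD /=.
    by rewrite a2 b2 addr0 coord_sum_free // (basis_free bX).
  by rewrite a1 b1 add0r coord_sum_free // (basis_free bY).
have vD h : derived H h <-> v h = 0.
  split=> [/UP/pUU[_ e]|/v0 e]; first by apply/rowP => i; rewrite vE !mxE e linear0.
  by apply/UP; rewrite -[h]pE e addr0 memv_pi.
have DZ h : derived H h -> center H h by rewrite dZ.
exists (Frame vw_inj vw_surj vD DZ) => k /=.
rewrite wE; apply/rowP => l; rewrite !mxE eqxx /=.
have YU : Y`_k \in U by rewrite (basis_mem bY) // mem_nth ?size_tuple.
by have [-> _] := pUU _ YU; rewrite coord_free ?(basis_free bY) // eq_sym.
Qed.

(** The exterior center is the line of w0, the first coordinate axis of H^2.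
    Modulo that line the bracket becomes a scalar alternating form [om] on V. *)
Section RankOne.
Variables (F : fieldType) (H : lieAlgType F) (m : nat) (fr : frame H m 2).
Local Notation vp := (vp fr).
Local Notation wp := (wp fr).
Local Notation J := (lin_span (jacobians fr)).
Local Notation d0 := (delta_mx 0 0 : 'rV[F]_2).
Local Notation d1 := (delta_mx 0 1 : 'rV[F]_2).
Variable w0 : H.
Hypotheses (w0E : wp w0 = d0) (w0D : derived H w0)
  (w0Z : exterior_center H w0)
  (notZ : ~ forall w, derived H w -> exterior_center H w).
Implicit Types a b c h : H.

Let om a b : F := wp (lie a b) 0 1.

Let omDl a b c : om (a + b) c = om a c + om b c.
Proof. by rewrite /om lieDl linearD mxE. Qed.
Let omDr a b c : om a (b + c) = om a b + om a c.
Proof. by rewrite /om lieDr linearD mxE. Qed.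
Let omZl k a b : om (k *: a) b = k * om a b.
Proof. by rewrite /om lieZl linearZ mxE. Qed.
Let omZr k a b : om a (k *: b) = k * om a b.
Proof. by rewrite /om lieZr linearZ mxE. Qed.
Let omC a b : om a b = - om b a.
Proof. by rewrite /om lieC linearN mxE. Qed.
Let omxx a : om a a = 0.
Proof. by rewrite /om liexx linear0 mxE. Qed.

Let rV2E (y : 'rV[F]_2) : y = y 0 0 *: d0 + y 0 1 *: d1.
Proof.
rewrite {1}[y]row_sum_delta big_ord_recl big_ord1.
by congr (_ + _ *: delta_mx _ _); [congr (y _ _)|]; apply/val_inj.
Qed.

(** V (x) w0 lies in J, because w0 is in the exterior center. *)
Let col0J (x : 'rV[F]_m) : J (x^T *m d0).
Proof.
rewrite -(vp_elt fr x 0) -w0E.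
apply: wedge_eq0_jacobian => //.
by rewrite wedgeC w0Z oppr0.
Qed.

(** Hence J is determined by the subspace K of V of those x with x (x) w1 in J,
    where w1 is the second axis. *)
Let K (x : 'rV[F]_m) := J (x^T *m d1).

Let KD x y : K x -> K y -> K (x + y).
Proof. by rewrite /K linearD mulmxDl; apply: lin_spanD. Qed.

Let KZ k x : K x -> K (k *: x).
Proof. by rewrite /K linearZ -scalemxAl; apply: lin_spanZ. Qed.

Let K_outer (x : 'rV[F]_m) (y : 'rV[F]_2) : K x -> J (x^T *m y).
Proof.
move=> Kx; rewrite [y]rV2E mulmxDr -!scalemxAr.
by apply: lin_spanD; apply: lin_spanZ => //; apply: col0J.
Qed.

(** Cyclic sums modulo V (x) w0. *)
Let K_jac a b c : K (om b c *: vp a + om c a *: vp b + om a b *: vp c).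
Proof.
have jabc : J (jac fr a b c) by apply: lin_span_gen; exists a, b, c.
have e (x : 'rV[F]_m) (y : 'rV[F]_2) :
    (y 0 1 *: x)^T *m d1 = x^T *m y - y 0 0 *: (x^T *m d0).
  by rewrite {2}[y]rV2E mulmxDr -!scalemxAr addrAC subrr add0r linearZ /= scalemxAl.
rewrite /K !linearD !mulmxDl /om !e [X in J (X + _)]addrACA -opprD addrACA -opprD.
apply: lin_spanD => //; apply/lin_spanN.
by apply: lin_spanD; [apply: lin_spanD|]; apply/lin_spanZ/col0J.
Qed.

(** K = V would give V (x) H^2 = J, and put all of H^2 in the exterior center. *)
Let notK : ~ forall x, K x.
Proof.
move=> Kall; apply: notZ => w wD a.
by rewrite wedgeC (jacobian_wedge_eq0 (fr := fr) wD) ?oppr0 //; apply/K_outer/Kall.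
Qed.

Let om_basis : exists e f, om e f = 1.
Proof.
suff [e [f ef]] : exists e f, om e f <> 0.
  exists ((om e f)^-1 *: e), f; rewrite omZl mulVf //; exact/eqP.
apply: contrapT => no; have om0 a b : om a b = 0.
  by apply: contrapT => ab; apply: no; exists a, b.
have wp0 w : derived H w -> wp w 0 1 = 0.
  move: w; apply: lin_span_ind => [|u v u0 v0|k v v0|_ [a [b ->]]] //.
  - by rewrite linear0 mxE.
  - by rewrite linearD mxE u0 v0 addr0.
  - by rewrite linearZ mxE v0 mulr0.
  - exact: om0.
have /eqP := wp0 _ (derived_wb fr 1).
by rewrite wp_elt mxE !eqxx oner_eq0.
Qed.

(** The form [om] has rank 2.  Choose om e f = 1 and let R be the orthogonal of e
    and f.  K contains R, since modulo V (x) w0 the cyclic sum of e, f and r in R is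
    r (x) w1.  If r, s in R had om r s <> 0, the triples (e, r, s) and (f, r, s) would put e and f
    in K too, contradicting [notK].  So [om] vanishes on R, K = R has codimension 2
    in V, and the quotient of V (x) H^2 by J is V / R. *)
Lemma rank_one_corank : jacobi_corank fr 2 /\ (2 <= m)%N.
Proof.
have [e [f ef]] := om_basis.
have fe : om f e = -1 by rewrite omC ef.
(* The coordinates along e and f and the component r h in R. *)
pose l1 h := om h f; pose l2 h := om e h.
pose r h := h + (- l1 h) *: e + (- l2 h) *: f.
have rE h : h = r h + l1 h *: e + l2 h *: f.
  by rewrite /r !scaleNr addrAC !subrK.
have r1 h : om (r h) f = 0 by rewrite /r !omDl !omZl ef omxx /l1; ring.
have r2 h : om e (r h) = 0 by rewrite /r !omDr !omZr ef omxx /l2; ring.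
have Kr h : K (vp (r h)).
  have := K_jac e f (r h); rewrite ef scale1r (omC f) r1 (omC (r h) e) r2.
  by rewrite !oppr0 !scale0r !add0r.
have r_om x y : om (r x) (r y) = 0.
  apply: contrapT => /eqP rxy; apply: notK => z.
  have Ke : K (vp e).
    have := K_jac e (r x) (r y); rewrite (omC (r y) e) !r2 oppr0 !scale0r !addr0.
    by move/(KZ (om (r x) (r y))^-1); rewrite scalerA mulVf // scale1r.
  have Kf : K (vp f).
    have := K_jac f (r x) (r y); rewrite (omC f) !r1 oppr0 !scale0r !addr0.
    by move/(KZ (om (r x) (r y))^-1); rewrite scalerA mulVf // scale1r.
  rewrite -(vp_elt fr z 0); move: (frame_elt fr z 0) => h.
  rewrite [h in vp h]rE; move: (r h) (Kr h) => h' Kh'.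
  by rewrite !linearD !linearZ; apply: KD; [apply: KD|]; try apply: KZ.
have omE x y : om x y = l1 x * l2 y - l2 x * l1 y.
  have := r_om x y; rewrite /r !omDl !omDr !omZl !omZr !omxx ef fe.
  rewrite -/(l1 x) -/(l2 y) (omC x e) -/(l2 x) (omC f y) -/(l1 y).
  by move=> h; apply/eqP; rewrite -subr_eq0 -h; apply/eqP; ring.
(* P computes the coordinates (l1, l2) on V, and the rows of Q are e and f. *)
pose P : 'M[F]_(m, 2) := \matrix_(i, j) if j == 0 then l1 (vb fr i) else l2 (vb fr i).
pose Q : 'M[F]_(2, m) := \matrix_(j, i) (if j == 0 then vp e else vp f) 0 i.
have om_wb a k : om (wb fr k) a = 0.
  by rewrite /om (frame_central fr (derived_wb fr k)) linear0 mxE.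
have om_sum a b : om a b = \sum_i vp a 0 i * om (vb fr i) b.
  have lsum n (g : 'I_n -> H) : om (\sum_i g i) b = \sum_i om (g i) b.
    elim/big_rec2: _ => [|i x y _ <-]; last by rewrite omDl.
    by rewrite /om lie0l linear0 mxE.
  rewrite {1}[a](frame_sum fr) omDl !lsum [X in _ + X]big1 => [|k _]; last first.
    by rewrite omZl om_wb mulr0.
  by rewrite addr0; apply: eq_bigr => i _; rewrite omZl.
have vpP h : vp h *m P = \row_j (if j == 0 then l1 h else l2 h).
  apply/rowP => j; rewrite !mxE; case: (altP (j =P 0)) => j0.
    by rewrite /l1 om_sum; apply: eq_bigr => i _; rewrite mxE j0.
  rewrite /l2 omC om_sum -sumrN; apply: eq_bigr => i _.
  by rewrite mxE (negbTE j0) /l2 (omC e) mulrN.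
have QP : Q *m P = 1%:M.
  apply/row_matrixP => j; rewrite row_mul row1.
  have -> : row j Q = if j == 0 then vp e else vp f.
    by apply/rowP => i; rewrite !mxE.
  apply/rowP => k; case: (altP (j =P 0)) => j0; rewrite vpP !mxE /= /l1 /l2.
    by rewrite j0 ef omxx; case: ifP.
  rewrite ef omxx; have -> : j = 1 by apply/val_inj; case: j j0 => [[|[]]].
  by case: k => [[|[]]].
split; last exact: mulmx1_min QP.
have [p pE] : exists p : {linear 'M[F]_(m, 2) -> 'rV[F]_2},
    p =1 fun N => (col 1 N)^T *m P.
  by apply: linear_ex => c M N; rewrite !linearP /= mulmxDl -scalemxAl.
have [s sE] : exists s : {linear 'rV[F]_2 -> 'M[F]_(m, 2)},
    s =1 fun q => (q *m Q)^T *m d1.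
  by apply: linear_ex => c x y; rewrite mulmxDl -scalemxAl linearP /= mulmxDl -scalemxAl.
have col_outer (x : 'rV[F]_m) (y : 'rV[F]_2) : (col 1 (x^T *m y))^T = y 0 1 *: x.
  by apply/rowP => i; rewrite !mxE big_ord1 !mxE mulrC.
exists p, s; split=> [q|a b c|N].
- rewrite sE pE col_outer mxE !eqxx scale1r -mulmxA QP; exact: mulmx1.
- rewrite pE /jac !linearD /= !col_outer !mulmxDl -!scalemxAl !vpP.
  rewrite -/(om b c) -/(om c a) -/(om a b) !omE.
  by apply/rowP => j; rewrite !mxE; case: ifP => _; ring.
(* N = n0 (x) w0 + n1 (x) w1; subtracting s (p N) replaces n1 by its component
   in R, and both terms are then in J. *)
pose h := frame_elt fr (col 1 N)^T 0.
have NE : N = ((col 0 N)^T)^T *m d0 + ((col 1 N)^T)^T *m d1.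
  apply/matrixP => i k; rewrite !trmxK !mxE !big_ord1 !mxE !eqxx /=.
  by case: k => [[|[]]] //= lt; rewrite ?mulr1 ?mulr0 ?addr0 ?add0r; congr (N _ _); apply/val_inj.
rewrite {1}NE sE pE -(vp_elt fr (col 1 N)^T 0) -/h vpP.
have -> : (\row_j (if j == 0 then l1 h else l2 h)) *m Q = l1 h *: vp e + l2 h *: vp f.
  by apply/rowP => i; rewrite !mxE big_ord_recl big_ord1 !mxE.
rewrite -addrA -mulmxBl -linearB; apply: lin_spanD; first exact: col0J.
have -> : vp h - (l1 h *: vp e + l2 h *: vp f) = vp (r h); last exact: Kr.
by rewrite /r !linearD !linearZ /= !scaleNr ?opprD addrA !scalerN.
Qed.

End RankOne.

(** A non-capable H has Z^(H) <> 0 by [exterior_center0_capable], and Z^(H) lies in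
    H^2, which has dimension 2.  So Z^(H) is H^2, and then V (x) H^2 = J, or it is a
    line, and then the frame is adapted to this line. *)
Lemma noncapable_corank (F : fieldType) (H : vectLieType F) :
    generalized_heisenberg 2 H -> ~ capable H ->
  exists fr : frame H (\dim {:H} - 2) 2,
    (exterior_center H = derived H -> jacobi_corank fr 0) /\
    (exterior_center H <> derived H ->
       jacobi_corank fr 2 /\ (2 <= \dim {:H} - 2)%N).
Proof.
move=> [dZ [U dU dimU]] ncap.
have UP h : derived H h <-> h \in U by rewrite -dU.
have -> : (\dim {:H} - 2)%N = \dim U^C by rewrite dimv_compl dimU.
(* Any frame serves to show that Z^(H) is contained in H^2. *)
have [fr0 _] := heisenberg_frame dZ dU (vbasisP U).
have ZD l : exterior_center H l -> derived H l.
  by move=> /(exterior_center_central fr0); rewrite dZ.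
have [w0 [w0Z w0N]] : exists w0, exterior_center H w0 /\ w0 <> 0.
  apply: contrapT => no; apply/ncap/exterior_center0_capable => l lZ.
  by apply: contrapT => lN; apply: no; exists l.
have w0U : w0 \in U by apply/UP/ZD.
have [w1 [w1U w1N]] : exists w1, w1 \in U /\ w1 \notin <[w0]>%VS.
  apply: contrapT => no.
  have : (U <= <[w0]>)%VS.
    apply/subvP => w wU; apply: contrapT => /negP wN; apply: no.
    by exists w.
  by move/dimvS; rewrite dimU dim_vline; case: eqP.
have bY : basis_of U [tuple w1; w0].
  rewrite basisEfree /= dimU leqnn andbT; apply/andP; split.
    by rewrite free_cons span_seq1 w1N seq1_free; apply/eqP.
  by apply/span_subvP => w; rewrite !inE => /orP[] /eqP ->.
have pY : perm_eq [:: w1; w0] [:: w0; w1] by rewrite (perm_catC [:: w1] [:: w0]).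
have bY' : basis_of U [tuple w0; w1] by rewrite -(perm_basis _ pY).
have [fr frE] := heisenberg_frame dZ dU bY'.
exists fr; split=> [ZE|ZN].
  apply: full_jacobi_corank => a w; rewrite -ZE => wZ.
  by rewrite wedgeC wZ oppr0.
apply: rank_one_corank (frE 0) (ZD _ w0Z) w0Z _ => DZ.
by apply/ZN/seteqP; split=> // l; apply: ZD.
Qed.

(** * Algebras given by a table *)

Lemma derived_morph (F : fieldType) (L M : lieAlgType F) (f : {linear L -> M}) h :
  (forall x y, f (lie x y) = lie (f x) (f y)) -> derived L h -> derived M (f h).
Proof.
move=> f_lie; move: h; apply: lin_span_ind => [|u v uD vD|c v vD|_ [a [b ->]]].
- by rewrite linear0; apply: lin_span0.
- by rewrite linearD; apply: lin_spanD.
- by rewrite linearZ; apply: lin_spanZ.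
- by rewrite f_lie; apply: derived_lie.
Qed.

Lemma frame_transport (F : fieldType) (H L : lieAlgType F) m r d (fr : frame L m r) :
    lie_isomorphic H L -> jacobi_corank fr d ->
  exists fr' : frame H m r, jacobi_corank fr' d.
Proof.
move=> [g [[g' gK g'K] g_lie]] frd.
have [h hE] := linear_ex (can2_linear gK g'K).
have h_lie x y : h (lie x y) = lie (h x) (h y).
  by rewrite !hE; apply: (can_inj gK); rewrite g_lie !g'K.
have fD x : derived H x <-> (vp fr \o g) x = 0.
  split=> [xD|/(frame_derived fr)/(derived_morph h_lie)]; last by rewrite hE gK.
  exact/(frame_derived fr)/derived_morph.
have fZ x : derived H x -> center H x.
  move=> /(derived_morph g_lie)/(frame_central fr) xZ y; apply: (can_inj gK).
  by rewrite g_lie xZ linear0.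
have f_inj x : (vp fr \o g) x = 0 -> (wp fr \o g) x = 0 -> x = 0.
  by move=> /= v0 w0; apply: (can_inj gK); rewrite linear0; apply: frame_inj v0 w0.
have f_surj x y : exists z, (vp fr \o g) z = x /\ (wp fr \o g) z = y.
  by have [z [zx zy]] := frame_surj fr x y; exists (g' z); rewrite /= g'K.
exists (Frame f_inj f_surj fD fZ); set fr' := Frame _ _ _ _.
have jacE a b c : jac fr' a b c = jac fr (g a) (g b) (g c).
  by rewrite /jac /= !g_lie.
have [p [s [psK pJ spK]]] := frd; exists p, s; split=> // [a b c|N].
  by rewrite jacE.
have -> // : jacobians fr' = jacobians fr.
apply/seteqP; split=> [_ [a [b [c ->]]]|_ [a [b [c ->]]]].
  by exists (g a), (g b), (g c).
by exists (g' a), (g' b), (g' c); rewrite jacE !g'K.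
Qed.

Section TableFrame.
Variables (F : fieldType) (n : nat) (t : lie_table F n) (m r : nat).
Local Notation L := (table_algebra t).
Hypothesis mrE : (m + r)%N = n.+1.

Lemma xcoord_xvec k i : (0 < k <= n.+1)%N -> (0 < i <= n.+1)%N ->
  xcoord (xvec F n k) i = (i == k)%:R.
Proof.
case: k i => [|k] [|i] //= kn i_n.
by rewrite /xcoord mxE eqxx -val_eqE /= !inordK // eqSS.
Qed.

Lemma table_lieE (x y : L) : lie x y = \sum_(e <- table_entries t)
    (xcoord x e.1.1 * xcoord y e.1.2 - xcoord x e.1.2 * xcoord y e.1.1) *: e.2.
Proof. by []. Qed.

Let ltm (i : 'I_m) : (i.+1 <= n.+1)%N.
Proof. by rewrite -mrE ltn_addr. Qed.

Let ltr (k : 'I_r) : ((m + k).+1 <= n.+1)%N.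
Proof. by rewrite -mrE ltn_add2l. Qed.

(** The first m basis vectors span a complement of H^2 and the last r ones, each
    of them a bracket, span H^2. *)
Lemma table_frame :
    (forall e, e \in table_entries t -> forall i : 'I_m, xcoord e.2 i.+1 = 0) ->
    (forall k : 'I_r, exists x y : L, lie x y = xvec F n (m + k).+1) ->
  exists fr : frame L m r,
    (forall x, vp fr x = \row_i xcoord x i.+1) /\
    (forall x, wp fr x = \row_k xcoord x (m + k).+1).
Proof.
move=> tV tW.
have [v vE] : exists v : {linear L -> 'rV[F]_m}, v =1 fun x => \row_i xcoord x i.+1.
  by apply: linear_ex => c x y; apply/rowP => i; rewrite !mxE xcoordD xcoordZ.
have [w wE] : exists w : {linear L -> 'rV[F]_r},
    w =1 fun x => \row_k xcoord x (m + k).+1.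
  by apply: linear_ex => c x y; apply/rowP => i; rewrite !mxE xcoordD xcoordZ.
have vw_inj x : v x = 0 -> w x = 0 -> x = 0.
  rewrite vE wE => v0 w0; apply/rowP => j; rewrite mxE.
  have -> : x 0 j = xcoord x j.+1 by rewrite /xcoord /= inord_val.
  have jmr : (j < m + r)%N by rewrite mrE.
  have := splitP (Ordinal jmr); case=> i /= ->.
    by have := congr1 (fun z : 'rV_ _ => z 0 i) v0; rewrite !mxE.
  by have := congr1 (fun z : 'rV_ _ => z 0 i) w0; rewrite !mxE.
have vw_surj x y : exists z, v z = x /\ w z = y.
  exists (castmx (erefl, mrE) (row_mx x y)); rewrite vE wE.
  split; apply/rowP => i; rewrite mxE /xcoord castmxE /= cast_ord_id.
    rewrite -(row_mxEl x y); congr (row_mx x y _ _); apply/val_inj.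
    by rewrite /= inordK // ltm.
  rewrite -(row_mxEr x y); congr (row_mx x y _ _); apply/val_inj.
  by rewrite /= inordK // ltr.
have vD x : derived L x <-> v x = 0.
  split=> [|v0].
    move: x; apply: lin_span_ind => [|x y x0 y0|c x x0|_ [x [y ->]]].
    - exact: linear0.
    - by rewrite linearD x0 y0 addr0.
    - by rewrite linearZ /= x0 scaler0.
    rewrite table_lieE linear_sum big_seq big1 // => e et; rewrite linearZ /= vE.
    rewrite (_ : \row_i _ = 0) ?scaler0 //; apply/rowP => i; rewrite !mxE.
    exact: tV.
  have -> : x = \sum_k w x 0 k *: (xvec F n (m + k).+1 : L).
    apply/eqP; rewrite -subr_eq0; apply/eqP/vw_inj.
      rewrite linearB v0 sub0r linear_sum big1 ?oppr0 // => k _.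
      rewrite linearZ /= vE (_ : \row_i _ = 0) ?scaler0 //; apply/rowP => i.
      rewrite !mxE xcoord_xvec ?ltr ?ltm // eqSS [_ == _](_ : _ = false) //.
      by apply/ltn_eqF/ltn_addr.
    rewrite linearB linear_sum; apply/eqP; rewrite subr_eq0; apply/eqP.
    rewrite {1}[w x]row_sum_delta; apply: eq_bigr => k _; rewrite linearZ /=.
    congr (_ *: _); apply/rowP => l; rewrite wE !mxE xcoord_xvec ?ltr //.
    by rewrite eqxx eqSS eqn_add2l.
  apply: lin_span_sum => k; apply/lin_spanZ.
  by have [y [z <-]] := tW k; apply: derived_lie.
have DZ x : derived L x -> center L x.
  move: x; apply: lin_span_ind => [|x y xZ yZ|c x xZ|_ [x [y ->]]].
  - exact: center0.
  - exact: centerD.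
  - exact: centerZ.
  - by move=> z; rewrite lieC [lie z _](table_lie2 z x y) oppr0.
by exists (Frame vw_inj vw_surj vD DZ).
Qed.

(** From here on, coordinates are functions of a natural number and matrices
    functions of two, so that every hypothesis of [table_corank] is checked by
    evaluating finite sums.  [B k] is the component on the basis vector number
    m + k + 1 of the bracket. *)
Variable B : nat -> (nat -> F) -> (nat -> F) -> F.

Definition cyclic (x y z : nat -> F) i k : F :=
  x i.+1 * B k y z + y i.+1 * B k z x + z i.+1 * B k x y.

Definition unit_coord a : nat -> F := fun i => (i == a)%:R.

(** R i k l is the coefficient, in the class of the matrix unit e_ik modulo J, of
    the basis element number l of the quotient, S l is the matrix that represents
    this basis element, and W i k lists a combination of cyclic sums on basis vectors
    that equals e_ik - \sum_l R i k l S l. *)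
Lemma table_corank d (fr : frame L m r) (R S : nat -> nat -> nat -> F)
    (W : nat -> nat -> seq (F * (nat * nat * nat))) :
    (forall x, vp fr x = \row_i xcoord x i.+1) ->
    (forall x, wp fr x = \row_k xcoord x (m + k).+1) ->
    (forall (x y : L) k, (k < r)%N ->
       xcoord (lie x y) (m + k).+1 = B k (xcoord x) (xcoord y)) ->
    (forall k x x' y y', (forall i, (0 < i <= n.+1)%N -> x i = x' i) ->
       (forall i, (0 < i <= n.+1)%N -> y i = y' i) -> B k x y = B k x' y') ->
    (forall l l', (l < d)%N -> (l' < d)%N ->
       \sum_(i <- iota 0 m) \sum_(k <- iota 0 r) S l i k * R i k l'
         = (l == l')%:R) ->
    (forall x y z l, (l < d)%N ->
       \sum_(i <- iota 0 m) \sum_(k <- iota 0 r) cyclic x y z i k * R i k l = 0) ->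
    (forall i k i' k', (i < m)%N -> (k < r)%N -> (i' < m)%N -> (k' < r)%N ->
       ((i == i') && (k == k'))%:R - \sum_(l <- iota 0 d) R i k l * S l i' k'
         = \sum_(w <- W i k) w.1 * cyclic (unit_coord w.2.1.1)
             (unit_coord w.2.1.2) (unit_coord w.2.2) i' k') ->
    (forall i k, (i < m)%N -> (k < r)%N -> all (fun w =>
       [&& 0 < w.2.1.1 <= n.+1, 0 < w.2.1.2 <= n.+1 & 0 < w.2.2 <= n.+1]%N) (W i k)) ->
  jacobi_corank fr d.
Proof.
move=> vE wE BE Bext SR cR RW Wn.
have iotaE (q : nat) (G : nat -> F) : \sum_(i <- iota 0 q) G i = \sum_(i < q) G i.
  by rewrite -(big_mkord xpredT) /index_iota subn0.
have jacE a b c (i : 'I_m) (k : 'I_r) :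
    jac fr a b c i k = cyclic (xcoord a) (xcoord b) (xcoord c) i k.
  by rewrite !mxE !big_ord1 !mxE !vE !wE !mxE !BE.
have [p pE] : exists p : {linear 'M[F]_(m, r) -> 'rV[F]_d},
    p =1 fun N => \row_l \sum_(i < m) \sum_(k < r) N i k * R i k l.
  apply: linear_ex => c M N; apply/rowP => l; rewrite !mxE mulr_sumr -big_split.
  apply: eq_bigr => i _; rewrite mulr_sumr -big_split; apply: eq_bigr => k _ /=.
  by rewrite !mxE mulrDl mulrA.
have [s sE] : exists s : {linear 'rV[F]_d -> 'M[F]_(m, r)},
    s =1 fun q => \matrix_(i, k) \sum_(l < d) q 0 l * S l i k.
  apply: linear_ex => c x y; apply/matrixP => i k; rewrite !mxE mulr_sumr -big_split.
  by apply: eq_bigr => l _ /=; rewrite !mxE mulrDl mulrA.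
exists p, s; split=> [q|a b c|N].
- rewrite sE pE; apply/rowP => l'; rewrite mxE.
  transitivity (\sum_(l < d) q 0 l * (l == l')%:R).
    transitivity (\sum_(i < m) \sum_(l < d) q 0 l *
                    \sum_(k < r) S l i k * R i k l').
      apply: eq_bigr => i _.
      transitivity (\sum_(k < r) \sum_(l < d) q 0 l * (S l i k * R i k l')).
        apply: eq_bigr => k _; rewrite mxE mulr_suml.
        by apply: eq_bigr => l _; rewrite mulrA.
      by rewrite exchange_big; apply: eq_bigr => l _; rewrite mulr_sumr.
    rewrite exchange_big; apply: eq_bigr => l _; rewrite -mulr_sumr -(SR _ _ (ltn_ord l) (ltn_ord l')).
    by rewrite iotaE; congr (_ * _); apply: eq_bigr => i _; rewrite iotaE.
  rewrite (bigD1 l') //= eqxx mulr1 big1 ?addr0 // => l /negPf.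
  by rewrite -val_eqE /= => ->; rewrite mulr0.
- rewrite pE; apply/rowP => l; rewrite !mxE.
  rewrite -[RHS](cR (xcoord a) (xcoord b) (xcoord c) l) // iotaE.
  by apply: eq_bigr => i _; rewrite iotaE; apply: eq_bigr => k _; rewrite jacE.
have -> : N - s (p N) = \sum_i \sum_k N i k *:
    (\sum_(w <- W i k) w.1 *: jac fr (xvec F n w.2.1.1 : L)
       (xvec F n w.2.1.2 : L) (xvec F n w.2.2 : L)).
  rewrite {1}[N]matrix_sum_delta.
  have -> : s (p N) = \sum_i \sum_k N i k *: s (\row_l R i k l).
    have {1}-> : p N = \sum_i \sum_k N i k *: (\row_l R i k l).
      apply/rowP => l; rewrite pE mxE summxE; apply: eq_bigr => i _.
      by rewrite summxE; apply: eq_bigr => k _; rewrite !mxE.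
    rewrite linear_sum; apply: eq_bigr => i _; rewrite linear_sum.
    by apply: eq_bigr => k _; rewrite linearZ.
  rewrite -sumrB; apply: eq_bigr => i _; rewrite -sumrB; apply: eq_bigr => k _.
  rewrite -scalerBr; congr (_ *: _); apply/matrixP => i' k'; rewrite summxE.
  rewrite sE !mxE (eq_sym i') (eq_sym k').
  rewrite (eq_bigr (fun l : 'I_d => R i k l * S l i' k')) => [|l _]; last first.
    by rewrite mxE.
  rewrite -(iotaE d (fun l => R i k l * S l i' k')) -!val_eqE /= RW //.
  rewrite !big_seq; apply: eq_bigr => w ww; rewrite mxE jacE; congr (_ * _).
  have /allP/(_ _ ww)/and3P[n1 n2 n3] := Wn i k (ltn_ord i) (ltn_ord k).
  have uE a j : (0 < a <= n.+1)%N -> (0 < j <= n.+1)%N ->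
      unit_coord a j = xcoord (xvec F n a) j.
    by move=> *; rewrite xcoord_xvec.
  rewrite /cyclic !uE ?ltm //.
  by congr (_ * _ + _ * _ + _ * _); apply: Bext => j jn; rewrite uE.
apply: lin_span_sum => i; apply: lin_span_sum => k; apply: lin_spanZ.
apply: lin_span_sum => w; apply/lin_spanZ/lin_span_gen.
by do 3!eexists.
Qed.

End TableFrame.

(** In all the tables the quotient of V (x) H^2 by J has a basis of classes of
    matrix units, whose positions are listed by [pos]; [rest] expresses the other
    matrix units. *)
Definition reduction (F : fieldType) (pos : seq (nat * nat)) (rest : nat -> nat -> nat -> F)
    (i k l : nat) : F :=
  if (i, k) \in pos then (index (i, k) pos == l)%:R else rest i k l.

Definition eval_at (F : fieldType) (pos : seq (nat * nat)) (l i k : nat) : F :=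
  (nth (0, 0)%N pos l == (i, k))%:R.

Ltac finite_check :=
  rewrite /= !(big_cons, big_nil) /cyclic /reduction /eval_at /unit_coord /=; ring.

Section Named.
Variable F : fieldType.

(** The cyclic sum on x1, x2, x3 is x3 (x) x4 - x2 (x) x5; it eliminates
    x3 (x) x4. *)
Lemma corank_5_8 : exists fr : frame (L_5_8 F) 3 2, jacobi_corank fr 5.
Proof.
have xE k : (0 < k <= 5)%N -> forall x y : L_5_8 F, xcoord (lie x y) k =
    (xcoord x 1 * xcoord y 2 - xcoord x 2 * xcoord y 1) * (k == 4)%:R
    + (xcoord x 1 * xcoord y 3 - xcoord x 3 * xcoord y 1) * (k == 5)%:R.
  move=> kn x y; rewrite table_lieE /= !big_cons big_nil addr0 xcoordD !xcoordZ /=.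
  by rewrite !xcoord_xvec.
have [//| | |fr [vE wE]] := @table_frame F 4 (LieTable (@nil2_5_8 F)) 3 2.
- move=> e; rewrite !inE => /orP[] /eqP -> [[|[|[]]]] //= lt;
    by rewrite xcoord_xvec.
- move=> k; exists (xvec F 4 1).
  exists (if k == 0 then xvec F 4 2 else xvec F 4 3).
  rewrite table_lieE /= !big_cons big_nil addr0 /=.
  by case: k => [[|[]]] //= lt; rewrite !xcoord_xvec //=
    !(mulr1, mulr0, subr0, oppr0, scale1r, scale0r, addr0, add0r).
pose pos := [:: (0, 0); (0, 1); (1, 0); (1, 1); (2, 1)]%N.
exists fr; apply: (@table_corank F 4 _ 3 2 erefl
  (fun k x y => if k is 0 then x 1%N * y 2%N - x 2%N * y 1%N
                else x 1%N * y 3%N - x 3%N * y 1%N) 5 fr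
  (reduction pos (fun _ _ l => (l == 3)%:R)) (eval_at F pos)
  (fun i k => if (i, k) == (2, 0)%N then [:: (1, (1, 2, 3)%N)] else [::]) vE wE).
- by move=> x y [|[|//]] _; rewrite xE //=; ring.
- by move=> [|k] x x' y y' hx hy; rewrite !hx ?hy.
- by move=> [|[|[|[|[|//]]]]] [|[|[|[|[|//]]]]] _ _; finite_check.
- by move=> x y z [|[|[|[|[|//]]]]] _; finite_check.
- by move=> [|[|[|//]]] [|[|//]] [|[|[|//]]] [|[|//]] _ _ _ _; finite_check.
- by move=> [|[|[|//]]] [|[|//]].
Qed.

(** The four cyclic sums have leading terms x1 (x) x5, x2 (x) x5, x3 (x) x5 and
    x4 (x) x5, and the remaining terms are multiples of the xi (x) x6. *)
Lemma corank_6_22 (eps : F) : exists fr : frame (L_6_22 eps) 4 2, jacobi_corank fr 4.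
Proof.
have xE k : (0 < k <= 6)%N -> forall x y : L_6_22 eps, xcoord (lie x y) k =
    (xcoord x 1 * xcoord y 2 - xcoord x 2 * xcoord y 1) * (k == 5)%:R
    + ((xcoord x 3 * xcoord y 4 - xcoord x 4 * xcoord y 3) * (k == 5)%:R
    + ((xcoord x 1 * xcoord y 3 - xcoord x 3 * xcoord y 1) * (k == 6)%:R
    + (xcoord x 2 * xcoord y 4 - xcoord x 4 * xcoord y 2) * (eps * (k == 6)%:R))).
  move=> kn x y; rewrite table_lieE /= !big_cons big_nil addr0 !xcoordD !xcoordZ ?xcoordD /=.
  by rewrite ?xcoordZ !xcoord_xvec.
have [//| | |fr [vE wE]] := @table_frame F 5 (LieTable (@nil2_6_22 F eps)) 4 2.
- move=> e; rewrite !inE => /or4P[] /eqP -> [[|[|[|[]]]]] //= lt;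
    by rewrite ?xcoordD ?xcoordZ !xcoord_xvec //= ?mulr0 ?addr0.
- move=> k; exists (xvec F 5 1).
  exists (if k == 0 then xvec F 5 2 else xvec F 5 3).
  rewrite table_lieE /= !big_cons big_nil addr0 /=.
  by case: k => [[|[]]] //= lt; rewrite !xcoord_xvec //=
    !(mulr1, mulr0, subr0, oppr0, scale1r, scale0r, addr0, add0r).
pose pos := [:: (0, 1); (1, 1); (2, 1); (3, 1)]%N.
exists fr; apply: (@table_corank F 5 _ 4 2 erefl
  (fun k x y =>
     if k is 0 then (x 1%N * y 2%N - x 2%N * y 1%N) + (x 3%N * y 4%N - x 4%N * y 3%N)
     else (x 1%N * y 3%N - x 3%N * y 1%N) + eps * (x 2%N * y 4%N - x 4%N * y 2%N)) 4 fr
  (reduction pos (fun i _ l => nth 0 (nth [::] [:: [:: 0; 0; 0; -1]; [:: 0; 0; eps]; [:: 0; 1]; [:: - eps]] i) l)) (eval_at F pos)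
  (fun i k => if k is 0 then
     [:: (1, nth (0, 0, 0)%N [:: (1, 3, 4); (2, 3, 4); (1, 2, 3); (1, 2, 4)]%N i)]
   else [::]) vE wE).
- by move=> x y [|[|//]] _; rewrite xE //=; ring.
- by move=> [|k] x x' y y' hx hy; rewrite !hx ?hy.
- by move=> [|[|[|[|//]]]] [|[|[|[|//]]]] _ _; finite_check.
- by move=> x y z [|[|[|[|//]]]] _; finite_check.
- by move=> [|[|[|[|//]]]] [|[|//]] [|[|[|[|//]]]] [|[|//]] _ _ _ _; finite_check.
- by move=> [|[|[|[|//]]]] [|[|//]].
Qed.

(** Elimination of the xi (x) x5 by the four cyclic sums, as for
    [corank_6_22]. *)
Lemma corank_6_7_2 (eta : F) : exists fr : frame (L_6_7_2 eta) 4 2, jacobi_corank fr 4.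
Proof.
have xE k : (0 < k <= 6)%N -> forall x y : L_6_7_2 eta, xcoord (lie x y) k =
    (xcoord x 1 * xcoord y 2 - xcoord x 2 * xcoord y 1) * (k == 5)%:R
    + ((xcoord x 1 * xcoord y 3 - xcoord x 3 * xcoord y 1) * (k == 6)%:R
    + ((xcoord x 2 * xcoord y 4 - xcoord x 4 * xcoord y 2) * (eta * (k == 6)%:R)
    + (xcoord x 3 * xcoord y 4 - xcoord x 4 * xcoord y 3) * ((k == 5)%:R + (k == 6)%:R))).
  move=> kn x y; rewrite table_lieE /= !big_cons big_nil addr0 !xcoordD !xcoordZ ?xcoordD /=.
  by rewrite ?xcoordZ !xcoord_xvec.
have [//| | |fr [vE wE]] := @table_frame F 5 (LieTable (@nil2_6_7_2 F eta)) 4 2.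
- move=> e; rewrite !inE => /or4P[] /eqP -> [[|[|[|[]]]]] //= lt;
    by rewrite ?xcoordD ?xcoordZ !xcoord_xvec //= ?mulr0 ?addr0.
- move=> k; exists (xvec F 5 1).
  exists (if k == 0 then xvec F 5 2 else xvec F 5 3).
  rewrite table_lieE /= !big_cons big_nil addr0 /=.
  by case: k => [[|[]]] //= lt; rewrite !xcoord_xvec //=
    !(mulr1, mulr0, subr0, oppr0, scale1r, scale0r, addr0, add0r).
pose pos := [:: (0, 1); (1, 1); (2, 1); (3, 1)]%N.
exists fr; apply: (@table_corank F 5 _ 4 2 erefl
  (fun k x y =>
     if k is 0 then (x 1%N * y 2%N - x 2%N * y 1%N) + (x 3%N * y 4%N - x 4%N * y 3%N)
     else (x 1%N * y 3%N - x 3%N * y 1%N) + eta * (x 2%N * y 4%N - x 4%N * y 2%N) + (x 3%N * y 4%N - x 4%N * y 3%N)) 4 fr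
  (reduction pos (fun i _ l => nth 0 (nth [::] [:: [:: -1; 0; 0; -1]; [:: 0; -1; eta]; [:: 0; 1]; [:: - eta]] i) l)) (eval_at F pos)
  (fun i k => if k is 0 then
     [:: (1, nth (0, 0, 0)%N [:: (1, 3, 4); (2, 3, 4); (1, 2, 3); (1, 2, 4)]%N i)]
   else [::]) vE wE).
- by move=> x y [|[|//]] _; rewrite xE //=; ring.
- by move=> [|k] x x' y y' hx hy; rewrite !hx ?hy.
- by move=> [|[|[|[|//]]]] [|[|[|[|//]]]] _ _; finite_check.
- by move=> x y z [|[|[|[|//]]]] _; finite_check.
- by move=> [|[|[|[|//]]]] [|[|//]] [|[|[|[|//]]]] [|[|//]] _ _ _ _; finite_check.
- by move=> [|[|[|[|//]]]] [|[|//]].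
Qed.

(** J contains every xi (x) x6 and xj (x) x7 apart from x3 (x) x6 and x1 (x) x7,
    and the sum of these two. *)
Lemma corank_1 : exists fr : frame (L_1 F) 5 2, jacobi_corank fr 1.
Proof.
have xE k : (0 < k <= 7)%N -> forall x y : L_1 F, xcoord (lie x y) k =
    (xcoord x 1 * xcoord y 2 - xcoord x 2 * xcoord y 1) * (k == 6)%:R
    + ((xcoord x 3 * xcoord y 4 - xcoord x 4 * xcoord y 3) * (k == 6)%:R
    + ((xcoord x 1 * xcoord y 5 - xcoord x 5 * xcoord y 1) * (k == 7)%:R
    + (xcoord x 2 * xcoord y 3 - xcoord x 3 * xcoord y 2) * (k == 7)%:R)).
  move=> kn x y; rewrite table_lieE /= !big_cons big_nil addr0 !xcoordD !xcoordZ /=.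
  by rewrite !xcoord_xvec.
have [//| | |fr [vE wE]] := @table_frame F 6 (LieTable (@nil2_1 F)) 5 2.
- move=> e; rewrite !inE => /or4P[] /eqP -> [[|[|[|[|[]]]]]] //= lt;
    by rewrite xcoord_xvec.
- move=> k; exists (xvec F 6 1).
  exists (if k == 0 then xvec F 6 2 else xvec F 6 5).
  rewrite table_lieE /= !big_cons big_nil addr0 /=.
  by case: k => [[|[]]] //= lt; rewrite !xcoord_xvec //=
    !(mulr1, mulr0, subr0, oppr0, scale1r, scale0r, addr0, add0r).
pose pos := [:: (0, 1)]%N.
exists fr; apply: (@table_corank F 6 _ 5 2 erefl
  (fun k x y =>
     if k is 0 then (x 1%N * y 2%N - x 2%N * y 1%N) + (x 3%N * y 4%N - x 4%N * y 3%N)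
     else (x 1%N * y 5%N - x 5%N * y 1%N) + (x 2%N * y 3%N - x 3%N * y 2%N)) 1 fr
  (reduction pos (fun i k l => - ((i, k) == (2, 0)%N)%:R)) (eval_at F pos)
  (fun i k => nth [::] (nth [::]
     [:: [:: [:: (1, (1, 3, 4)%N)]; [::]];
         [:: [:: (1, (2, 3, 4)%N); (1, (1, 4, 5)%N)];
             [:: (1, (3, 4, 5)%N); (-1, (1, 2, 5)%N)]];
         [:: [:: (1, (1, 2, 3)%N)]; [:: (-1, (1, 3, 5)%N)]];
         [:: [:: (1, (1, 2, 4)%N)]; [:: (-1, (1, 4, 5)%N)]];
         [:: [:: (1, (3, 4, 5)%N)]; [:: (1, (2, 3, 5)%N)]]] i) k) vE wE).
- by move=> x y [|[|//]] _; rewrite xE //=; ring.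
- by move=> [|k] x x' y y' hx hy; rewrite !hx ?hy.
- by move=> [|//] [|//] _ _; finite_check.
- by move=> x y z [|//] _; finite_check.
- by move=> [|[|[|[|[|//]]]]] [|[|//]] [|[|[|[|[|//]]]]] [|[|//]] _ _ _ _;
    finite_check.
- by move=> [|[|[|[|[|//]]]]] [|[|//]].
Qed.

End Named.

(** * The two squares of a generalized Heisenberg algebra of rank 2 *)

Lemma half_bin n : (2 <= n - 2)%N ->
  ('C(n - 2, 2) + 2 = ((n - 1) * (n - 4))./2 + 3)%N.
Proof.
move=> n2; rewrite bin2.
have -> : ((n - 2) * (n - 2).-1 = ((n - 1) * (n - 4)).+2)%N by nia.
by rewrite /= addn2 addn3.
Qed.

Theorem proposition3p6 (F : fieldType) (n : nat) (H : vectLieType F)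
    (dimH : \dim (fullv : {vspace H}) = n)
    (heisH : generalized_heisenberg 2 H) :
  (~ capable H ->
     ((exterior_center H = derived H ->
         lie_isomorphic (tensor_square H) (abelian_lie F ((n - 2) ^ 2)%N)) /\
      (exterior_center H <> derived H ->
         lie_isomorphic (tensor_square H) (abelian_lie F ((n - 2) ^ 2 + 2)%N))) /\
     ((exterior_center H = derived H ->
         lie_isomorphic (exterior_square H)
           (abelian_lie F ((n - 3) * (n - 2))./2)) /\
      (exterior_center H <> derived H ->
         lie_isomorphic (exterior_square H)
           (abelian_lie F (((n - 1) * (n - 4))./2 + 3)%N)))) /\
  (capable H ->
     ((lie_isomorphic H (L_5_8 F) ->
         lie_isomorphic (tensor_square H) (abelian_lie F 14)) /\
      ((exists eps : F, lie_isomorphic H (L_6_22 eps)) \/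
       (2%N \in [pchar F] /\
        exists eta : F,
          (eta = 0 \/ ~ exists gamma : F, eta = gamma ^+ 2 + gamma) /\
          lie_isomorphic H (L_6_7_2 eta)) ->
         lie_isomorphic (tensor_square H) (abelian_lie F 20)) /\
      (lie_isomorphic H (L_1 F) ->
         lie_isomorphic (tensor_square H) (abelian_lie F 26))) /\
     ((lie_isomorphic H (L_5_8 F) ->
         lie_isomorphic (exterior_square H) (abelian_lie F 8)) /\
      ((exists eps : F, lie_isomorphic H (L_6_22 eps)) \/
       (2%N \in [pchar F] /\
        exists eta : F,
          (eta = 0 \/ ~ exists gamma : F, eta = gamma ^+ 2 + gamma) /\
          lie_isomorphic H (L_6_7_2 eta)) ->
         lie_isomorphic (exterior_square H) (abelian_lie F 10)) /\
      (lie_isomorphic H (L_1 F) ->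
         lie_isomorphic (exterior_square H) (abelian_lie F 11)))).
Proof.
split=> [ncap|_].
  have [fr] := noncapable_corank heisH ncap.
  move: dimH fr => -> fr [corank0 corank2].
  do ![split] => hZ.
  - by have := tensor_square_iso (corank0 hZ); rewrite addn0.
  - by have [frd _] := corank2 hZ; apply: tensor_square_iso frd.
  - have := exterior_square_iso (corank0 hZ).
    by rewrite addn0 bin2 mulnC -subnS.
  - have [frd m2] := corank2 hZ; rewrite -half_bin //.
    exact: exterior_square_iso frd.
have frame6 : (exists eps : F, lie_isomorphic H (L_6_22 eps)) \/
    (2%N \in [pchar F] /\ exists eta : F,
      (eta = 0 \/ ~ exists gamma : F, eta = gamma ^+ 2 + gamma) /\
      lie_isomorphic H (L_6_7_2 eta)) ->
    exists fr : frame H 4 2, jacobi_corank fr 4.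
  move=> [[eps /frame_transport]|[_ [eta [_ /frame_transport]]]] isoH.
    by have [fr /isoH] := corank_6_22 eps.
  by have [fr /isoH] := corank_6_7_2 eta.
split; split=> [/frame_transport isoH|].
- have [fr /isoH[fr' frd]] := corank_5_8 F; exact: tensor_square_iso frd.
- split=> [/frame6[fr frd]|/frame_transport isoH].
    exact: tensor_square_iso frd.
  have [fr /isoH[fr' frd]] := corank_1 F; exact: tensor_square_iso frd.
- have [fr /isoH[fr' frd]] := corank_5_8 F; exact: exterior_square_iso frd.
split=> [/frame6[fr frd]|/frame_transport isoH].
  exact: exterior_square_iso frd.
have [fr /isoH[fr' frd]] := corank_1 F; exact: exterior_square_iso frd.
Qed.
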